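(* Let $L$ be an oriented classical link, considered as a pseudolink without precrossings. Then the Jablan polynomial $\Delta_J(L)$ (which is defined up to multiplication by units of $\Lambda_J=\mathbb{Z}[\tfrac12,s^{\pm1},t^{\pm1},\tfrac1{s+t}]$) is a homogeneous polynomial in $s$ and $t$ which specializes to the (one-variable) Alexander polynomial of $L$, up to powers of $2$, by setting $s=1$.
   Context: Let $D$ be a diagram of an oriented pseudolink (a link diagram with classical crossings and possibly precrossings, i.e. self-intersections without over/under information). Its semiarcs are the edges of the graph obtained by regarding every crossing as a 4-valent vertex (a crossingless closed component counts as one semiarc). Consider the operations $$x\,\underline{\triangleright}\,y=tx+(s-t)y,\quad x\,\overline{\triangleright}\,y=sx,\quad x\,\underline{\bullet}\,y=x\,\overline{\bullet}\,y=\tfrac{s+t}{2}x+\tfrac{s-t}{2}y .$$ Each crossing gives two linear equations among the variables attached to its four semiarcs. Draw the crossing with both strands oriented upward, with ends bottom-left (BL), bottom-right (BR), top-left (TL), top-right (TR), so the strands run BL$\to$TR and BR$\to$TL; write $x$ for the variable of BR and $y$ for that of TR. Then the equations are: - positive crossing (BL$\to$TR is the over strand): TL $=x\,\underline{\triangleright}\,y$, BL $=y\,\overline{\triangleright}\,x$; - negative crossing (BR$\to$TL is the over strand): TL $=x\,\overline{\triangleright}\,y$, BL $=y\,\underline{\triangleright}\,x$; - precrossing: TL $=x\,\underline{\bullet}\,y$, BL $=y\,\overline{\bullet}\,x$. The Jablan psyquandle matrix of $D$ is the coefficient matrix of this homogeneous linear system over $\Lambda_J=\mathbb{Z}[\tfrac12,s^{\pm1},t^{\pm1},\tfrac1{s+t}]$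 (columns indexed by the semiarcs, rows by the crossing equations). If there are $n$ columns, the codimension 1 minors are the $(n-1)\times(n-1)$ minors. The Jablan polynomial $\Delta_J(L)$ is any generator of the smallest principal ideal of $\Lambda_J$ containing the ideal generated by the codimension 1 minors of this matrix. It is defined up to units of $\Lambda_J$, which are of the form $\pm2^is^jt^k(s+t)^l$, and it may be normalized up to sign by clearing denominators and cancelling common factors of $2,s,t,s+t$. The Alexander polynomial of $L$ is likewise defined only up to units $\pm t^k$; the comparison of $\Delta_J(L)|_{s=1}$ with it is to be read modulo these unit ambiguities (those of $\Lambda_J$ specialized at $s=1$). *)

(* Defs.v *)
From mathcomp Require Import all_boot all_order all_fingroup all_algebra.
From mathcomp Require Import mpoly.

Set Implicit Arguments.
Unset Strict Implicit.
Unset Printing Implicit Defensive.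

Import GRing.Theory.

Local Open Scope ring_scope.

(* Every crossing is drawn with both strands upward, BL -> TR and BR -> TL.   *)
(* An end of a crossing at which a strand leaves it is a pair (c, b), TL for  *)
(* b = false and TR for b = true; an end at which a strand enters is a pair   *)
(* (c, b), BL for b = false and BR for b = true.  [next] sends an outgoing    *)
(* end to the incoming end reached by following the semiarc that starts       *)
(* there.  [circle] indexes the crossingless closed components.  The position *)
(* of these circles, and of the connected components of the diagram relative  *)
(* to each other, is not recorded: the crossing equations do not involve it.  *)
Record preshadow := Preshadow {
  crossing : finType;
  circle : finType;
  next : {perm crossing * bool}
}.

Section Planarity.
Variable G : preshadow.

(* (d, true) is the semiarc starting at the outgoing end d, traversed         *)
(* forward; (d, false) is the same semiarc traversed backward.                *)
Definition dart : finType := ((crossing G * bool) * bool)%type.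

(* Walk along the dart with a region on the left and turn left at the         *)
(* crossing that is reached: BL |-> TL, BR |-> BL, TL |-> TR, TR |-> BR.      *)
Definition turn_left (d : dart) : dart :=
  let: (e, forward) := d in
  if forward then
    let: (c, at_right) := next G e in
    if at_right then (((next G)^-1)%g (c, false), false) else ((c, false), true)
  else
    let: (c, at_right) := e in
    if at_right then (((next G)^-1)%g (c, true), false) else ((c, true), true).

Definition adjacent : rel (crossing G) := fun c c' =>
  [exists b, ((next G (c, b)).1 == c') || ((next G (c', b)).1 == c)].

(* Euler's formula V - E + F = 2 C with E = 2 V, C being the number of        *)
(* connected components of the 4-valent graph: every component is embedded    *)
(* in a sphere.                                                               *)
Definition planar : Prop :=
  (fcard turn_left predT = #|crossing G| + 2 * n_comp adjacent predT)%N.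

End Planarity.

Record shadow := Shadow {
  shadow_map :> preshadow;
  shadow_planar : planar shadow_map
}.

Section Semiarcs.
Variable G : preshadow.

(* A semiarc through crossings is named by the outgoing end where it starts. *)
Definition semiarc : finType := (crossing G * bool + circle G)%type.

Definition semiarc_out (e : crossing G * bool) : semiarc := inl e.
Definition semiarc_in (e : crossing G * bool) : semiarc :=
  inl (((next G)^-1)%g e).

Definition TL (c : crossing G) := semiarc_out (c, false).
Definition TR (c : crossing G) := semiarc_out (c, true).
Definition BL (c : crossing G) := semiarc_in (c, false).
Definition BR (c : crossing G) := semiarc_in (c, true).

End Semiarcs.

Inductive crossing_kind := Positive | Negative | Precrossing.

Record pseudolink_diagram := PseudolinkDiagram {
  pseudolink_shadow :> shadow;
  kind : crossing pseudolink_shadow -> crossing_kind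
}.

Record link_diagram := LinkDiagram {
  link_shadow :> shadow;
  is_positive : crossing link_shadow -> bool
}.

Definition pseudolink_of_link (L : link_diagram) : pseudolink_diagram :=
  @PseudolinkDiagram (link_shadow L)
    (fun c => if is_positive c then Positive else Negative).

(* Ideals of a subring S of a field K. *)
Section Ideals.
Variables (K : fieldType) (S : K -> Prop).

Definition included (I J : K -> Prop) : Prop := forall x, I x -> J x.

Definition ideal_generated_by (X : K -> Prop) (x : K) : Prop :=
  exists (n : nat) (a g : 'I_n -> K),
    [/\ forall i, S (a i), forall i, X (g i) & x = \sum_(i < n) a i * g i].

Definition principal_ideal (d : K) (x : K) : Prop :=
  exists2 a, S a & x = a * d.

Definition generates_smallest_principal_ideal (I : K -> Prop) (d : K) : Prop :=
  [/\ S d, included I (principal_ideal d)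
    & forall e, S e -> included I (principal_ideal e) ->
        included (principal_ideal d) (principal_ideal e)].

(* Reordering rows or columns only changes the sign of a minor. *)
Definition codim1_minor m n (A : 'M[K]_(m, n)) (x : K) : Prop :=
  exists (k : nat) (f : 'I_k -> 'I_m) (g : 'I_k -> 'I_n),
    [/\ k.+1 = n, injective f, injective g & x = \det (mxsub f g A)].

Definition order_polynomial m n (A : 'M[K]_(m, n)) (d : K) : Prop :=
  generates_smallest_principal_ideal (ideal_generated_by (codim1_minor A)) d.

End Ideals.

Definition Qst : fieldType := {fraction {mpoly int[2]}}.

Definition poly_st (P : {mpoly int[2]}) : Qst := tofrac P.

Definition s : Qst := poly_st 'X_ord0.
Definition t : Qst := poly_st 'X_ord_max.

(* Z[1/2, s, 1/s, t, 1/t, 1/(s+t)] *)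
Definition LambdaJ (x : Qst) : Prop :=
  exists (P : {mpoly int[2]}) (i j k l : nat),
    x = poly_st P / (2%:R ^+ i * s ^+ j * t ^+ k * (s + t) ^+ l).

Section JablanOperations.
Variable V : lmodType Qst.
Implicit Types x y : V.

Definition under_op x y : V := t *: x + (s - t) *: y.
Definition over_op x y : V := s *: x.
Definition pre_op x y : V := ((s + t) / 2%:R) *: x + ((s - t) / 2%:R) *: y.

End JablanOperations.

Section Jablan.
Variable D : pseudolink_diagram.

Definition semiarc_var (a : semiarc D) : 'rV[Qst]_#|semiarc D| :=
  delta_mx 0 (enum_rank a).

(* The two linear forms that the crossing c equates to zero. *)
Definition crossing_equation (c : crossing D) (second : bool) :
    'rV[Qst]_#|semiarc D| :=
  let x := semiarc_var (BR c) in
  let y := semiarc_var (TR c) in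
  let tl := semiarc_var (TL c) in
  let bl := semiarc_var (BL c) in
  match kind c with
  | Positive => if second then bl - over_op y x else tl - under_op x y
  | Negative => if second then bl - under_op y x else tl - over_op x y
  | Precrossing => if second then bl - pre_op y x else tl - pre_op x y
  end.

Definition jablan_matrix :
    'M[Qst]_(#|{: crossing D * bool}|, #|semiarc D|) :=
  \matrix_(i < #|{: crossing D * bool}|)
    crossing_equation (enum_val i).1 (enum_val i).2.

Definition jablan_polynomial : Qst -> Prop :=
  order_polynomial LambdaJ jablan_matrix.

End Jablan.

Definition Qt : fieldType := {fraction {poly int}}.

Definition poly_t (p : {poly int}) : Qt := tofrac p.

Definition t1 : Qt := poly_t 'X.

(* Z[t, 1/t] *)
Definition Laurent (x : Qt) : Prop :=
  exists (p : {poly int}) (k : nat), x = poly_t p / t1 ^+ k.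

(* The Alexander matrix of a link diagram: one column for each arc, running   *)
(* from undercrossing to undercrossing, and for each crossing the relation    *)
(* left = t right + (1 - t) over obtained by Fox calculus from the Wirtinger  *)
(* presentation, left and right being the arcs ending at the undercrossing on *)
(* the two sides of the over strand.                                          *)
Section Alexander.
Variable L : link_diagram.

Definition over_in (c : crossing L) : semiarc L :=
  if is_positive c then BL c else BR c.
Definition over_out (c : crossing L) : semiarc L :=
  if is_positive c then TR c else TL c.
Definition under_left (c : crossing L) : semiarc L :=
  if is_positive c then TL c else BL c.
Definition under_right (c : crossing L) : semiarc L :=
  if is_positive c then BR c else TR c.

Definition overpass : rel (semiarc L) := fun x y =>
  [exists c, ((x == over_in c) && (y == over_out c))
          || ((y == over_in c) && (x == over_out c))].

Definition arc_of (x : semiarc L) : {set semiarc L} :=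
  [set y | connect overpass x y].

Definition arcs : {set {set semiarc L}} := [set arc_of x | x : semiarc L].

Definition arc_var (x : semiarc L) : 'rV[Qt]_#|arcs| :=
  \row_(j < #|arcs|) (enum_val j == arc_of x)%:R.

Definition alexander_matrix : 'M[Qt]_(#|crossing L|, #|arcs|) :=
  \matrix_(i < #|crossing L|)
    let c := enum_val i in
    (1 - t1) *: arc_var (over_in c) + t1 *: arc_var (under_right c)
      - arc_var (under_left c).

Definition alexander_polynomial : Qt -> Prop :=
  order_polynomial Laurent alexander_matrix.

End Alexander.

(* P(s, t) |-> P(1, t) *)
Definition at_s1 (P : {mpoly int[2]}) : {poly int} :=
  mmap (@polyC int) (fun i : 'I_2 => if i == ord0 then 1 else 'X) P.

(* The units (+/-) 2^i s^j t^k (s+t)^l of LambdaJ at s = 1. *)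
Definition unit_at_s1 (u : Qt) : Prop :=
  exists (b : bool) (i k l : int),
    u = (-1) ^+ b * 2%:R ^ i * t1 ^ k * (1 + t1) ^ l.

(* Main.v *)
Require Import Defs.
From mathcomp Require Import all_boot all_order all_fingroup all_algebra.
From mathcomp Require Import mpoly zify ring.

(** The idea is that the Jablan polynomial is the Alexander polynomial, made
    homogeneous by substituting [t / s] for its variable.

    Number the semiarcs so that the two left ends of each crossing, drawn
    upward, carry one more than its two right ends.  Such an Alexander numbering
    [w] exists on a planar diagram ([alexander_numbering]).  If the variable of
    each semiarc [x] is replaced by [s ^ w x] times a new variable, then at a
    crossing the over equation says that the new variables of the over strand
    agree, and the under equation becomes [left = T right + (1 - T) over] with
    [T = t / s], which is the Alexander relation.  So the Jablan matrix and the
    Alexander matrix at [t / s] present the same module over [LambdaJ], although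
    their sizes differ.  By Fitting's lemma
    ([minor_ideal_isomorphic_cokernel]) their minors of corank one generate the
    same ideal ([jablan_alexander_ideal]).

    The minors of the Alexander matrix are polynomials in [Z[T]], and they have
    a greatest common divisor [g] that remains one in every ring of fractions of
    [Z[T]] ([localized_gcd]).  Hence [g] generates the smallest principal ideal
    over [Z[t, 1/t]] ([Laurent_generator]).  Over [LambdaJ] the generator is
    [g] at [t / s], or [g] made homogeneous ([LambdaJ_generator]): in a domain
    every factor of a nonzero homogeneous element is homogeneous, so divisibility of
    homogeneous polynomials in [s] and [t] reduces to divisibility in [Z[T]].

    Finally, two generators differ by a unit.  A unit of [LambdaJ] is a product
    of powers of [2], [s], [t] and [s + t] up to sign, because [2], [T] and
    [1 + T] are prime in [Z[T]] ([LambdaJ_associate]).  These factors are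
    homogeneous, so every polynomial generator is homogeneous and takes at
    [s = 1] the value [g] up to the allowed units. *)

Set Implicit Arguments.
Unset Strict Implicit.
Unset Printing Implicit Defensive.

Import Order.TTheory GRing.Theory Num.Theory.

Local Open Scope ring_scope.

(** * Alexander numbering of a planar diagram *)

Lemma sum_enum_val (K : nmodType) (I : finType) (F : I -> K) :
  \sum_(i < #|I|) F (enum_val i) = \sum_x F x.
Proof.
rewrite (reindex (@enum_rank I)) /=; last exact/onW_bij/enum_rank_bij.
by apply: eq_bigr => x _; rewrite enum_rankK.
Qed.

(** Adjoining to [M] the columns that read off the coordinates in [R] makes its
    rows independent. *)
Lemma rank_ge_determining_coordinates (K : fieldType) m n (M : 'M[K]_(m, n))
    (R : pred 'I_m) :
    (forall u : 'rV_m, u *m M = 0 -> (forall i, R i -> u 0 i = 0) -> u = 0) ->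
  (m <= \rank M + #|R|)%N.
Proof.
move=> R_det; pose N : 'M_(m, #|R|) := colsub enum_val (1%:M : 'M[K]_m).
suff /eqP rank_MN : row_free (row_mx M N).
  rewrite -[leqLHS]rank_MN -mxrank_tr tr_row_mx -addsmxE.
  apply: leq_trans (leq_of_leqif (mxrank_adds_leqif _ _)) _.
  by rewrite !mxrank_tr leq_add2l rank_leq_col.
apply: inj_row_free => u; rewrite mul_mx_row -row_mx0 => /eq_row_mx[uM].
rewrite mulmx_colsub mulmx1 => /rowP uN; apply: R_det => // i Ri.
by have := uN (enum_rank_in Ri i); rewrite !mxE enum_rankK_in.
Qed.

Section AlexanderNumbering.
Variable G : preshadow.

Let next_inv : crossing G * bool -> crossing G * bool := (Defs.next G)^-1%g.

Definition turn_back_right (d : dart G) : dart G :=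
  let: (e, forward) := d in
  if forward then
    if e.2 then ((e.1, false), false) else (next_inv e, true)
  else
    let: (c, at_right) := Defs.next G e in
    if at_right then ((c, true), false) else (next_inv (c, true), true).

Lemma turn_left_inj : injective (@turn_left G).
Proof.
suff /can_inj : cancel (@turn_left G) turn_back_right by [].
case=> -[c b] [] /=; last by case: b; rewrite /next_inv /= ?permKV.
by case next_e: (Defs.next G (c, b)) => [c' []] /=;
  rewrite /next_inv ?permKV -next_e permK.
Qed.

(** The orbits of [turn_left] are the regions of the diagram, each seen from the
    darts that have it on their left. *)
Definition region_function (T : Type) (r : dart G -> T) : Prop :=
  forall d, r (turn_left d) = r d.

Lemma region_at_left T (r : dart G -> T) c : region_function r ->
  r (next_inv (c, false), true) = r ((c, false), true).
Proof. by move=> r_tl; rewrite -r_tl /= permKV. Qed.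

Lemma region_at_bottom T (r : dart G -> T) c : region_function r ->
  r (next_inv (c, true), true) = r (next_inv (c, false), false).
Proof. by move=> r_tl; rewrite -r_tl /= permKV. Qed.

Lemma region_at_right T (r : dart G -> T) c : region_function r ->
  r ((c, true), false) = r (next_inv (c, true), false).
Proof. by move=> r_tl; rewrite -r_tl. Qed.

Lemma region_at_top T (r : dart G -> T) c : region_function r ->
  r ((c, false), false) = r ((c, true), true).
Proof. by move=> r_tl; rewrite -r_tl. Qed.

Lemma region_function_froot T (f : dart G -> T) :
  region_function (f \o froot (@turn_left G)).
Proof.
move=> d /=; congr f; apply/(fingraph.rootP (fconnect_sym turn_left_inj)).
by rewrite (fconnect_sym turn_left_inj) fconnect1.
Qed.

Lemma region_connect T (r : dart G -> T) d d' :
  region_function r -> fconnect (@turn_left G) d d' -> r d' = r d.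
Proof.
move=> r_tl /connectP[p path_p ->] {d'}.
by elim: p d path_p => //= d' p IHp d /andP[/eqP<- /IHp->].
Qed.

(** Each of the four regions around a crossing lies beside two consecutive ends
    of it, and its contributions through these ends cancel. *)
Lemma region_jump_circulation (K : pzRingType) (r : dart G -> K)
    (v : crossing G -> K) : region_function r ->
  \sum_e (r (e, true) - r (e, false)) * (v (Defs.next G e).1 - v e.1) = 0.
Proof.
move=> r_tl; under eq_bigr do rewrite mulrBr; rewrite sumrB.
rewrite (reindex_perm (Defs.next G)^-1%g) /=.
under eq_bigr do rewrite permKV.
rewrite -sumrB; under eq_bigr do rewrite -mulrBl.
transitivity (\sum_c \sum_b
  ((r (next_inv (c, b), true) - r (next_inv (c, b), false)) -
   (r ((c, b), true) - r ((c, b), false))) * v c).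
  by rewrite pair_bigA; apply: eq_bigr => -[c b].
rewrite big1 // => c _; rewrite big_bool /= -mulrDl.
rewrite region_at_left // region_at_bottom // region_at_right // region_at_top //.
by rewrite !opprB subrKA [X in _ + X]addrC subrKA subrKA subrr mul0r.
Qed.

Let froot_left := froot (@turn_left G).
Let adj_root := fingraph.root (@adjacent G).

Lemma adjacent_sym (c c' : crossing G) : adjacent c c' = adjacent c' c.
Proof.
by rewrite /adjacent; apply: eq_existsb => b; rewrite orbC.
Qed.

Lemma constant_on_component (T : Type) (v : crossing G -> T) c :
  (forall e, v (Defs.next G e).1 = v e.1) -> v c = v (adj_root c).
Proof.
move=> v_edge; rewrite /adj_root; have /connectP[p path_p ->] := connect_root (@adjacent G) c.
elim: p c path_p => //= c' p IHp c /andP[/existsP[b adj_c] /IHp<-].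
by case/orP: adj_c => /eqP<-; rewrite v_edge.
Qed.

(** A region function without jumps takes one value at each crossing, and
    adjacent crossings share it. *)
Lemma jumpless_region_function (T : Type) (r : dart G -> T) d :
    region_function r -> (forall e, r (e, true) = r (e, false)) ->
  r d = r ((adj_root d.1.1, false), true).
Proof.
move=> r_tl r_jump; pose v c := r ((c, false), true).
have r_out e b : r (e, b) = v e.1.
  suff: r (e, true) = v e.1 by case: b; rewrite ?r_jump // -r_jump.
  by case: e => c [] //; rewrite -region_at_top // -r_jump.
have v_edge e : v (Defs.next G e).1 = v e.1.
  rewrite -(r_out e true) /v -region_at_left //.
  case next_e: (Defs.next G e) => [c []] /=; last by rewrite /next_inv -next_e permK.
  by rewrite r_jump -region_at_bottom // /next_inv -next_e permK.
by case: d => e b; rewrite r_out -[RHS]/(v _) -constant_on_component.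
Qed.

(** The cellular boundary from regions to edges.  A region is represented by the
    root of its orbit of darts; the rows of the other darts are zero. *)
Definition boundary1 : 'M[rat]_(#|dart G|, #|{: crossing G * bool}|) :=
  \matrix_(i, j) ((froot_left (enum_val j, true) == enum_val i)%:R
                  - (froot_left (enum_val j, false) == enum_val i)%:R).

(** The cellular boundary from edges to crossings. *)
Definition boundary0 : 'M[rat]_(#|{: crossing G * bool}|, #|crossing G|) :=
  \matrix_(j, k) (((Defs.next G (enum_val j)).1 == enum_val k)%:R
                  - ((enum_val j).1 == enum_val k)%:R).

Lemma pick_sum (I : finType) (u : 'rV[rat]_#|I|) (x : I) :
  \sum_i u 0 i * (x == enum_val i)%:R = u 0 (enum_rank x).
Proof.
rewrite (bigD1 (enum_rank x)) //= enum_rankK eqxx mulr1 big1 ?addr0 // => i.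
by rewrite -(can_eq enum_valK) enum_rankK eq_sym => /negPf; rewrite eq_sym => ->; rewrite mulr0.
Qed.

Lemma mul_boundary1 (u : 'rV_#|dart G|) j : (u *m boundary1) 0 j =
  u 0 (enum_rank (froot_left (enum_val j, true)))
  - u 0 (enum_rank (froot_left (enum_val j, false))).
Proof.
rewrite mxE; under eq_bigr do rewrite mxE mulrBr.
by rewrite sumrB !pick_sum.
Qed.

Lemma boundary1_boundary0 : boundary1 *m boundary0 = 0.
Proof.
apply/matrixP=> i k; rewrite !mxE.
pose r d := (froot_left d == enum_val i)%:R : rat.
pose v c := (c == enum_val k)%:R : rat.
under eq_bigr do rewrite !mxE.
rewrite (sum_enum_val (fun e => (r (e, true) - r (e, false)) *
                                (v (Defs.next G e).1 - v e.1))).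
apply: region_jump_circulation.
exact: (region_function_froot (fun d => (d == enum_val i)%:R)).
Qed.

Lemma const_boundary0 : (const_mx 1 : 'rV_#|{: crossing G * bool}|) *m boundary0 = 0.
Proof.
apply/rowP=> k; rewrite !mxE; under eq_bigr do rewrite !mxE mul1r.
rewrite (sum_enum_val (fun e => ((Defs.next G e).1 == enum_val k)%:R - (e.1 == enum_val k)%:R)).
rewrite sumrB (reindex_perm (Defs.next G)^-1%g) /=.
by under eq_bigr do rewrite permKV; rewrite subrr.
Qed.

(** A left kernel vector is a region function without jumps, apart from its
    coordinates at the darts that are not roots, where it is arbitrary; so it is
    determined by these coordinates and by one region for each component. *)
Lemma rank_boundary1 :
  (fcard (@turn_left G) predT <=
     \rank boundary1 + n_comp (@adjacent G) predT)%N.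
Proof.
pose roots_ := [pred i : 'I_#|dart G| | froots (@turn_left G) (enum_val i)].
pose based := [seq enum_rank (froot_left ((c, false), true)) |
                c : crossing G in fingraph.roots (@adjacent G)].
pose R := [predU predC roots_ & based].
have rootsE : #|roots_| = fcard (@turn_left G) predT.
  rewrite -(card_image enum_val_inj); apply: eq_card => d.
  rewrite !inE andbT; apply/imageP/idP => [[i] |root_d]; first by rewrite inE => ? ->.
  by exists (enum_rank d); rewrite ?inE enum_rankK.
have basedE : (#|based| <= n_comp (@adjacent G) predT)%N.
  apply: leq_trans (card_size _) _; rewrite size_map -cardE.
  by apply/subset_leq_card/subsetP=> c; rewrite !inE andbT.
have R_det (u : 'rV_#|dart G|) :
    u *m boundary1 = 0 -> (forall i, R i -> u 0 i = 0) -> u = 0.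
  move=> u_ker u_R; pose r d := u 0 (enum_rank (froot_left d)).
  have r_tl : region_function r.
    exact: (region_function_froot (fun d => u 0 (enum_rank d))).
  have r_jump e : r (e, true) = r (e, false).
    have := mul_boundary1 u (enum_rank e); rewrite u_ker mxE enum_rankK.
    by move/esym/eqP; rewrite subr_eq0 => /eqP.
  apply/rowP=> i; rewrite mxE.
  have [root_i|nroot_i] := boolP (roots_ i); last by apply: u_R; apply/orP; left.
  transitivity (r (enum_val i)).
    by rewrite /r /froot_left (eqP root_i) enum_valK.
  rewrite jumpless_region_function //; apply: u_R.
  apply/orP; right; apply/imageP; exists (adj_root (enum_val i).1.1) => //.
  exact: roots_root (sym_connect_sym adjacent_sym) _.
have := rank_ge_determining_coordinates R_det.
move=> rank_ge; rewrite -rootsE -(leq_add2r #|predC roots_|) cardC card_ord.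
apply: leq_trans rank_ge _; rewrite -addnA leq_add2l addnC.
apply: leq_trans (leq_addr #|[predI predC roots_ & based]| _) _.
by rewrite cardUI leq_add2l.
Qed.

Lemma rank_boundary0 :
  (#|crossing G| <= \rank boundary0 + n_comp (@adjacent G) predT)%N.
Proof.
pose R := [pred k : 'I_#|crossing G| | fingraph.roots (@adjacent G) (enum_val k)].
have <-: #|R| = n_comp (@adjacent G) predT.
  rewrite -(card_image enum_val_inj); apply: eq_card => c.
  rewrite !inE andbT; apply/imageP/idP => [[k] |root_c]; first by rewrite inE => ? ->.
  by exists (enum_rank c); rewrite ?inE enum_rankK.
rewrite -mxrank_tr; apply: rank_ge_determining_coordinates => u u_ker u_R.
pose v c := u 0 (enum_rank c).
have v_edge e : v (Defs.next G e).1 = v e.1.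
  apply/eqP; rewrite -subr_eq0; move/rowP/(_ (enum_rank e)): u_ker.
  rewrite !mxE => /eqP; under eq_bigr do rewrite !mxE enum_rankK mulrBr.
  by rewrite sumrB !pick_sum.
apply/rowP=> k; rewrite mxE -[k]enum_valK -/(v _) (constant_on_component _ v_edge).
apply: u_R; rewrite /R /= enum_rankK.
exact: roots_root (sym_connect_sym adjacent_sym) _.
Qed.

(** By Euler's formula the ranks of the two boundary matrices add up to the
    number of edges, so every circulation is the jump of a region function: a
    sphere has no first homology.  The circulation that is [1] on each edge thus
    is the jump of a rational region function, and its values next to the edges
    stay a numbering when they are rounded down, as they differ by integers. *)
Theorem alexander_numbering : planar G ->
  exists w : crossing G * bool -> int, forall c,
    [/\ w (next_inv (c, true)) = w (c, true),
        w (next_inv (c, false)) = w (c, true) + 1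
      & w (c, false) = w (c, true) + 1].
Proof.
move=> euler.
have : ((const_mx 1 : 'rV_#|{: crossing G * bool}|) <= boundary1)%MS.
  have : ((const_mx 1 : 'rV_#|{: crossing G * bool}|) <= kermx boundary0)%MS.
    by apply/sub_kermxP; exact: const_boundary0.
  move=> /submx_trans; apply.
  have sub : (boundary1 <= kermx boundary0)%MS.
    exact/sub_kermxP/boundary1_boundary0.
  rewrite -(geq_leqif (mxrank_leqif_sup sub)) mxrank_ker.
  have card_E : #|{: crossing G * bool}| = (#|crossing G| * 2)%N.
    by rewrite card_prod card_bool.
  have := leq_add rank_boundary0 rank_boundary1.
  rewrite euler leq_subLR -/(boundary0); lia.
case/submxP=> u u_jump.
pose r d := u 0 (enum_rank (froot_left d)).
have r_tl : region_function r.
  exact: (region_function_froot (fun d => u 0 (enum_rank d))).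
have r_jump e : r (e, true) = r (e, false) + 1.
  have := mul_boundary1 u (enum_rank e); rewrite -u_jump mxE enum_rankK.
  by move/esym/eqP; rewrite subr_eq addrC => /eqP.
have floor1 (x : rat) : Num.floor (x + 1) = Num.floor x + 1.
  by rewrite floorDrz ?rpred1 ?floor1.
exists (fun e => Num.floor (r (e, true))) => c.
have topE : r ((c, false), true) = r ((c, true), true) + 1.
  by rewrite r_jump region_at_top.
split.
- by rewrite [in LHS]r_jump [in RHS]r_jump region_at_right.
- by rewrite region_at_left // topE floor1.
- by rewrite topE floor1.
Qed.

End AlexanderNumbering.

(** * Fitting ideals over a subring of a field *)

Record subring (K : fieldType) (S : K -> Prop) : Prop := Subring {
  subring1 : S 1;
  subringN : forall x, S x -> S (- x);
  subringD : forall x y, S x -> S y -> S (x + y);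
  subringM : forall x y, S x -> S y -> S (x * y)
}.

Section Subrings.
Variables (K : fieldType) (S : K -> Prop).
Hypothesis S_sub : subring S.

Lemma subring0 : S 0.
Proof.
by rewrite -(subrr 1); apply: subringD => //;
  [|apply: subringN => //]; apply: subring1.
Qed.

Lemma subring_sum (I : Type) (r : seq I) (P : pred I) (F : I -> K) :
  (forall i, P i -> S (F i)) -> S (\sum_(i <- r | P i) F i).
Proof. by move=> SF; elim/big_ind: _ => //; [apply: subring0|apply: subringD]. Qed.

Lemma subring_prod (I : Type) (r : seq I) (P : pred I) (F : I -> K) :
  (forall i, P i -> S (F i)) -> S (\prod_(i <- r | P i) F i).
Proof. by move=> SF; elim/big_ind: _ => //; [apply: subring1|apply: subringM]. Qed.

Lemma subring_nat n : S n%:R.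
Proof.
elim: n => [|n IHn]; first exact: subring0.
by rewrite -natr1; apply: subringD => //; apply: subring1.
Qed.

Lemma subringX x n : S x -> S (x ^+ n).
Proof.
by move=> Sx; elim: n => [|n IHn]; rewrite ?exprS; [apply: subring1|apply: subringM].
Qed.

Definition over_subring m n (A : 'M[K]_(m, n)) : Prop := forall i j, S (A i j).

Lemma over_subring0 m n : over_subring (0 : 'M_(m, n)).
Proof. by move=> i j; rewrite mxE; apply: subring0. Qed.

Lemma over_subring1 n : over_subring (1%:M : 'M_n).
Proof. by move=> i j; rewrite mxE; apply: subring_nat. Qed.

Lemma over_subringN m n (A : 'M_(m, n)) : over_subring A -> over_subring (- A).
Proof. by move=> SA i j; rewrite mxE; apply: subringN. Qed.

Lemma over_subringD m n (A B : 'M_(m, n)) :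
  over_subring A -> over_subring B -> over_subring (A + B).
Proof. by move=> SA SB i j; rewrite mxE; apply: subringD. Qed.

Lemma over_subringZ m n a (A : 'M_(m, n)) :
  S a -> over_subring A -> over_subring (a *: A).
Proof. by move=> Sa SA i j; rewrite mxE; apply: subringM. Qed.

Lemma over_subringM m n p (A : 'M_(m, n)) (B : 'M_(n, p)) :
  over_subring A -> over_subring B -> over_subring (A *m B).
Proof.
by move=> SA SB i j; rewrite mxE; apply: subring_sum => k _; apply: subringM.
Qed.

Lemma over_subring_sub m n p q (f : 'I_p -> 'I_m) (g : 'I_q -> 'I_n)
  (A : 'M_(m, n)) : over_subring A -> over_subring (mxsub f g A).
Proof. by move=> SA i j; rewrite mxE. Qed.

Lemma over_subring_row m n1 n2 (A : 'M_(m, n1)) (B : 'M_(m, n2)) :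
  over_subring A -> over_subring B -> over_subring (row_mx A B).
Proof. by move=> SA SB i j; rewrite mxE; case: split. Qed.

Lemma over_subring_col m1 m2 n (A : 'M_(m1, n)) (B : 'M_(m2, n)) :
  over_subring A -> over_subring B -> over_subring (col_mx A B).
Proof. by move=> SA SB i j; rewrite mxE; case: split. Qed.

Lemma over_subring_block m1 m2 n1 n2 (A : 'M_(m1, n1)) (B : 'M_(m1, n2))
  (C : 'M_(m2, n1)) (D : 'M_(m2, n2)) :
  over_subring A -> over_subring B -> over_subring C -> over_subring D ->
  over_subring (block_mx A B C D).
Proof.
by move=> SA SB SC SD; apply: over_subring_col; apply: over_subring_row.
Qed.

Lemma over_subring_det n (A : 'M_n) : over_subring A -> S (\det A).
Proof.
move=> SA; apply: subring_sum => s _; apply: (subringM S_sub).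
  by apply: subringX; apply: (subringN S_sub); apply: subring1.
by apply: subring_prod => i _.
Qed.

Section GeneratedIdeal.
Variable X : K -> Prop.
Notation "<X>" := (ideal_generated_by S X).

Lemma ideal_gen x : X x -> <X> x.
Proof.
move=> Xx; exists 1%N, (fun=> 1), (fun=> x).
by split=> // [_|]; rewrite ?big_ord1 ?mul1r //; apply: subring1.
Qed.

Lemma ideal0 : <X> 0.
Proof. by exists 0%N, (fun=> 0), (fun=> 0); split=> [[]|[]|]; rewrite ?big_ord0. Qed.

Lemma idealD x y : <X> x -> <X> y -> <X> (x + y).
Proof.
move=> [n [a [g [Sa Xg ->]]]] [p [b [h [Sb Xh ->]]]].
pose u T (f1 : 'I_n -> T) (f2 : 'I_p -> T) i :=
  match split i with inl j => f1 j | inr j => f2 j end.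
exists (n + p)%N, (u K a b), (u K g h).
split=> [i|i|]; try by rewrite /u; case: split.
rewrite big_split_ord /=; congr (_ + _); apply: eq_bigr => i _; rewrite /u.
  by rewrite (unsplitK (inl i)).
by rewrite (unsplitK (inr i)).
Qed.

Lemma idealM a x : S a -> <X> x -> <X> (a * x).
Proof.
move=> Sa [n [b [g [Sb Xg ->]]]]; exists n, (fun i => a * b i), g.
split=> // [i|]; first exact: subringM.
by rewrite mulr_sumr; apply: eq_bigr => i _; rewrite mulrA.
Qed.

Lemma ideal_sum (I : Type) (r : seq I) (F : I -> K) :
  (forall i, <X> (F i)) -> <X> (\sum_(i <- r) F i).
Proof. by move=> XF; elim/big_ind: _ => //; [apply: ideal0|apply: idealD]. Qed.

Lemma ideal_min (J : K -> Prop) :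
    J 0 -> (forall x y, J x -> J y -> J (x + y)) ->
    (forall a x, S a -> J x -> J (a * x)) ->
  included X J -> included <X> J.
Proof.
move=> J0 JD JM XJ _ [n [a [g [Sa Xg ->]]]].
by elim/big_ind: _ => // i _; apply: JM => //; apply: XJ.
Qed.

End GeneratedIdeal.

Lemma ideal_included (X Y : K -> Prop) :
  included X (ideal_generated_by S Y) ->
  included (ideal_generated_by S X) (ideal_generated_by S Y).
Proof.
by move=> XY; apply: ideal_min => //; [apply: ideal0|apply: idealD|apply: idealM].
Qed.

(** Repeated row or column indices are allowed: they only add zero minors. *)
Definition minor q m n (A : 'M[K]_(m, n)) (x : K) : Prop :=
  exists (f : 'I_q -> 'I_m) (g : 'I_q -> 'I_n), x = \det (mxsub f g A).

Notation minor_ideal q A := (ideal_generated_by S (minor q A)).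

Lemma codim1_minor_ideal m n (A : 'M[K]_(m, n)) x : (0 < n)%N ->
  ideal_generated_by S (codim1_minor A) x <-> minor_ideal n.-1 A x.
Proof.
move=> n_gt0; split; apply: ideal_included => {x} x.
  case=> k [f [g [n_k _ _ ->]]]; have ->: n.-1 = k by rewrite -n_k.
  by apply: ideal_gen; exists f, g.
case=> f [g ->].
have [/injectiveP inj_f|/injectivePn[i [j neq_ij eq_f]]] := boolP (injectiveb f);
  last first.
  rewrite (determinant_alternate neq_ij) => [|k]; first exact: ideal0.
  by rewrite !mxE eq_f.
have [/injectiveP inj_g|/injectivePn[i [j neq_ij eq_g]]] := boolP (injectiveb g);
  last first.
  rewrite -det_tr (determinant_alternate neq_ij) => [|k]; first exact: ideal0.
  by rewrite !mxE eq_g.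
by apply: ideal_gen; exists n.-1, f, g; rewrite prednK.
Qed.

(** One half of the Cauchy-Binet formula: the determinant is multilinear in
    its rows, and the rows of [P *m Q] are combinations of those of [Q]. *)
Lemma det_mul_rows q m (P : 'M[K]_(q, m)) (Q : 'M[K]_(m, q)) :
  \det (P *m Q) =
  \sum_(h : {ffun 'I_q -> 'I_m}) (\prod_i P i (h i)) * \det (rowsub h Q).
Proof.
transitivity (\sum_(s : 'S_q) \sum_(h : {ffun 'I_q -> 'I_m})
   (-1) ^+ s * \prod_i (P i (h i) * Q (h i) (s i))).
  apply: eq_bigr => s _; rewrite -big_distrr /=; congr (_ * _).
  rewrite -(bigA_distr_bigA (fun i j => P i j * Q j (s i))) /=.
  by apply: eq_bigr => i _; rewrite mxE.
rewrite exchange_big; apply: eq_bigr => h _ /=.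
rewrite big_distrr /=; apply: eq_bigr => s _.
rewrite big_split /= mulrCA; congr (_ * (_ * _)).
by apply: eq_bigr => i _; rewrite mxE.
Qed.

Lemma det_sandwich q m n (A : 'M[K]_(m, n)) (P : 'M_(q, m)) (Q : 'M_(n, q)) :
  over_subring P -> over_subring Q -> minor_ideal q A (\det (P *m A *m Q)).
Proof.
move=> SP SQ; rewrite -mulmxA det_mul_rows; apply: ideal_sum => h.
apply: idealM; first by apply: subring_prod => i _.
rewrite -det_tr.
have ->: (rowsub h (A *m Q))^T = Q^T *m (rowsub h A)^T.
  by rewrite -trmx_mul mul_rowsub_mx.
rewrite det_mul_rows; apply: ideal_sum => h'; apply: idealM.
  by apply: subring_prod => i _; rewrite mxE.
apply: ideal_gen; exists h, h'; rewrite -det_tr; congr (\det _).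
by apply/matrixP=> i j; rewrite !mxE.
Qed.

Lemma minor_ideal_mul q m n m' n' (A : 'M[K]_(m, n)) (B : 'M[K]_(m', n'))
    (P : 'M_(m', m)) (Q : 'M_(n, n')) :
    over_subring P -> over_subring Q -> B = P *m A *m Q ->
  included (minor_ideal q B) (minor_ideal q A).
Proof.
move=> SP SQ ->; apply: ideal_included => _ [f [g ->]].
rewrite mxsub_mul -(mul_rowsub_mx f P A).
by apply: det_sandwich; apply: over_subring_sub.
Qed.

(** [None] marks a column that need not come from [A].  Laplace expansion along
    such a column, or along any column if there is none, lowers the size by one
    and keeps the bound on the number of these columns. *)
Lemma det_mixed_columns m n (A : 'M[K]_(m, n)) p q (X : 'M[K]_p)
    (U : 'M_(p, m)) (h : 'I_p -> option 'I_n) :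
    over_subring X -> over_subring U ->
    (forall j l, h j = Some l -> col j X = U *m col l A) ->
    (q + #|[pred j | h j == None]| <= p)%N ->
  minor_ideal q A (\det X).
Proof.
elim: p => [|p IHp] in X U h * => SX SU colX.
  rewrite leqn0 addn_eq0 => /andP[/eqP-> _].
  rewrite det_mx00; apply: ideal_gen.
  have from0 (T : Type) : 'I_0 -> T by case.
  by exists (from0 'I_m), (from0 'I_n); rewrite det_mx00.
have [q_big|q_small] := ltnP p q.
  have [->|neq_q] := eqVneq q p.+1; last first.
    by rewrite leqNgt (leq_trans _ (leq_addr _ _)) // ltn_neqAle eq_sym neq_q.
  rewrite -[X in (_ <= X)%N]addn0 leq_add2l leqn0 => /eqP/card0_eq h_some.
  have h_ex j : exists l, h j = Some l.
    by have := h_some j; rewrite !inE; case: (h j) => [l|//]; exists l.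
  have [g gP] := fin_all_exists h_ex.
  have ->: X = U *m A *m colsub g 1%:M.
    rewrite mulmx_colsub mulmx1; apply/matrixP=> i j.
    have /matrixP/(_ i 0) := colX _ _ (gP j); rewrite !mxE => ->.
    by apply: eq_bigr => k _; rewrite mxE.
  by apply: det_sandwich => //; apply/over_subring_sub/over_subring1.
move=> le_q.
have [j0 j0P] : exists j0, (q + #|[pred j | h (lift j0 j) == None]| <= p)%N.
  have [j0 h_j0|h_some] := pickP [pred j | h j == None].
    exists j0; rewrite -ltnS; apply: leq_trans le_q; rewrite -addnS leq_add2l.
    rewrite [leqRHS](cardD1 j0) [j0 \in _]h_j0 add1n ltnS -(card_image (@lift_inj _ j0)).
    apply/subset_leq_card/subsetP=> _ /imageP[j h_j ->].
    by rewrite !inE eq_sym neq_lift; apply: h_j.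
  exists ord0; rewrite eq_card0 ?addn0 // => j; exact: h_some.
rewrite (expand_det_col X j0); apply: ideal_sum => i; apply: idealM => //.
apply: idealM.
  by apply: subringX; apply: (subringN S_sub); apply: subring1.
apply: (IHp _ (row' i U) (fun j => h (lift j0 j))) => // [k l|k l|j l h_jl].
- by rewrite !mxE.
- by rewrite mxE.
have /matrixP colj := colX _ _ h_jl; apply/matrixP=> k z.
have := colj (lift i k) z; rewrite !mxE => ->.
by apply: eq_bigr => w _; rewrite !mxE.
Qed.

(** A minor of the block matrix uses at most [j] columns of the identity block,
    and all its other columns come from [A]. *)
Lemma minor_ideal_stable k m n j (A : 'M[K]_(m, n)) x : over_subring A ->
    (k <= n)%N ->
  minor_ideal (n + j - k) (block_mx A 0 0 (1%:M : 'M_j)) x <->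
  minor_ideal (n - k) A x.
Proof.
move=> SA le_kn; rewrite -(addnBAC _ le_kn).
split; apply: ideal_included => {x} _ [f [g ->]].
  have [/injectiveP inj_g|/injectivePn[a [b neq_ab eq_g]]] :=
    boolP (injectiveb g); last first.
    rewrite -det_tr (determinant_alternate neq_ab) => [|c]; first exact: ideal0.
    by rewrite !mxE eq_g.
  pose h i := match split (g i) with inl l => Some l | inr _ => None end.
  apply: (@det_mixed_columns _ _ _ _ _ _ (lsubmx (rowsub f 1%:M)) h).
  - apply/over_subring_sub/over_subring_block => //;
      [exact: over_subring0|exact: over_subring0|exact: over_subring1].
  - by rewrite lsubmxEsub; do 2!apply: over_subring_sub; apply: over_subring1.
  - move=> i l; rewrite /h; case: (splitP (g i)) => // l' g_i [<-].
    rewrite [LHS](_ : _ = rowsub f 1%:M *m col_mx (col l' A) 0).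
      by rewrite -{1}[rowsub f 1%:M]hsubmxK mul_row_col mulmx0 addr0.
    rewrite mul_rowsub_mx mul1mx; apply/matrixP=> a b; rewrite !mxE.
    have ->: g i = lshift j l' by apply: val_inj.
    by case: (splitP (f a)) => a' _; rewrite !mxE (unsplitK (inl l')) ?mxE.
  rewrite leq_add2l -(card_image inj_g) -[X in (_ <= X)%N](card_ord j).
  rewrite -(card_image (@rshift_inj n j) predT).
  apply/subset_leq_card/subsetP=> _ /imageP[i h_i ->].
  move: h_i; rewrite inE /h; case: (splitP (g i)) => // l g_i _.
  by apply/imageP; exists l => //; apply: val_inj.
pose u p p' (e : 'I_(n - k) -> 'I_p) i : 'I_(p + p') :=
  match split i with inl a => lshift p' (e a) | inr b => rshift p b end.
apply: ideal_gen; exists (u m j f), (u n j g).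
transitivity (\det (block_mx (mxsub f g A) 0 0 (1%:M : 'M_j))).
  by rewrite det_ublock det1 mulr1.
congr (\det _); apply/matrixP=> a b; rewrite [RHS]mxE /u.
have splitL c : split (lshift j c : 'I_(n - k + j)) = inl c.
  exact: (unsplitK (inl c)).
have splitR c : split (rshift (n - k) c : 'I_(n - k + j)) = inr c.
  exact: (unsplitK (inr c)).
by case: (split_ordP a) => a' ->; case: (split_ordP b) => b' ->;
  rewrite ?splitL ?splitR ?block_mxEul ?block_mxEur ?block_mxEdl ?block_mxEdr !mxE.
Qed.

(** Fitting's lemma.  Both sets of relations, together with relations that
    express each set of generators through the other one, present the same
    module on the union of the generators; so the two enlarged matrices have
    the same row space, while each of them is, up to an invertible change of
    the generators, a stabilisation of one of the given matrices. *)
Theorem minor_ideal_isomorphic_cokernel k m n m' n'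
    (A : 'M[K]_(m, n)) (B : 'M[K]_(m', n'))
    (P : 'M[K]_(n', n)) (Q : 'M[K]_(n, n'))
    (U : 'M_(m', m)) (V : 'M_(m, m')) (W : 'M_(n', m')) (Z : 'M_(n, m)) x :
    over_subring A -> over_subring B -> over_subring P -> over_subring Q ->
    over_subring U -> over_subring V -> over_subring W -> over_subring Z ->
    B *m P = U *m A -> A *m Q = V *m B ->
    1%:M - P *m Q = W *m B -> 1%:M - Q *m P = Z *m A ->
    (k <= n)%N -> (k <= n')%N ->
  minor_ideal (n - k) A x <-> minor_ideal (n' - k) B x.
Proof.
move=> SA SB SP SQ SU SV SW SZ BP AQ PQ QP le_kn le_kn'.
have S0 p q : over_subring (0 : 'M_(p, q)) := @over_subring0 p q.
have S1 p : over_subring (1%:M : 'M_p) := @over_subring1 p.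
have SN := over_subringN; have Sb := over_subring_block.
rewrite -(minor_ideal_stable n' x SA le_kn) -(minor_ideal_stable n x SB le_kn').
have -> : (n' + n - k = n + n' - k)%N by rewrite addnC.
set q := (n + n' - k)%N.
(* The first generators are those of [B], the last ones those of [A]. *)
pose CA := block_mx 0 A 1%:M (- P) : 'M_(m + n', n' + n).
pose CB := block_mx B 0 Q (- 1%:M) : 'M_(m' + n, n' + n).
have CA_CB : CA = block_mx V (- A) W P *m CB.
  rewrite /CB mulmx_block !mulNmx !mulmxN !mulmx1 !mulmx0 -AQ -PQ.
  by rewrite subrr subrK opprK !add0r.
have CB_CA : CB = block_mx U B (- Z) Q *m CA.
  rewrite /CA mulmx_block !mulNmx !mulmxN !mulmx1 !mulmx0 -BP -QP.
  rewrite [B *m P - _]subrr opprB addrAC [Q *m P - _]subrr.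
  by rewrite !add0r oppr0 add0r.
have CA_A : CA = block_mx A 0 0 1%:M *m block_mx 0 1%:M 1%:M (- P).
  by rewrite ?/CA ?/CB mulmx_block !mulmx1 !mulmx0 !mul0mx !mul1mx !add0r !addr0.
have A_CA : block_mx A 0 0 1%:M = CA *m block_mx P 1%:M 1%:M 0.
  by rewrite ?/CA ?/CB mulmx_block !mulmx1 !mulmx0 !mul0mx !mul1mx !add0r !addr0 subrr.
have CB_B : CB = block_mx B 0 0 1%:M *m block_mx 1%:M 0 Q (- 1%:M).
  by rewrite ?/CA ?/CB mulmx_block !mulmx1 !mulmx0 !mul0mx !mul1mx !add0r !addr0.
have B_CB : block_mx B 0 0 1%:M = CB *m block_mx 1%:M 0 Q (- 1%:M).
  rewrite /CB mulmx_block !mulNmx !mulmxN !mulmx1 !mulmx0 !mul0mx !mul1mx.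
  by rewrite oppr0 opprK [Q - _]subrr !addr0 add0r.
split=> [A_x|B_x].
  have : minor_ideal q CB x.
    apply: (minor_ideal_mul (P := block_mx V (- A) W P)
              (Q := block_mx P 1%:M 1%:M 0)) A_x; 
      do ?[exact: Sb | by apply: Sb => //; apply: SN].
    by rewrite A_CA CA_CB.
  apply: (minor_ideal_mul (P := 1%:M) (Q := block_mx 1%:M 0 Q (- 1%:M))) => //.
    by apply: Sb => //; apply: SN.
  by rewrite mul1mx.
have : minor_ideal q CA x.
  apply: (minor_ideal_mul (P := block_mx U B (- Z) Q)
            (Q := block_mx 1%:M 0 Q (- 1%:M))) B_x; do ?[by apply: Sb => //; apply: SN].
  by rewrite B_CB CB_CA.
apply: (minor_ideal_mul (P := 1%:M) (Q := block_mx 0 1%:M 1%:M (- P))) => //.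
  by apply: Sb => //; apply: SN.
by rewrite mul1mx.
Qed.

End Subrings.

(** * The Jablan module and the Alexander module *)

Lemma expfz_succ (K : fieldType) (a : K) (k : int) : a != 0 -> a ^ (k + 1) = a * a ^ k.
Proof. by move=> a0; rewrite expfzDr // mulrC expr1z. Qed.

Lemma expfz_pred (K : fieldType) (a : K) (k : int) :
  a != 0 -> a ^ (- (k + 1)) * a = a ^ (- k).
Proof. by move=> a0; rewrite mulrC -expfz_succ // opprD addrNK. Qed.

Section JablanAlexander.
Variable L : link_diagram.

(** The variable is left free because the matrix is needed at the variable of
    [Z[T]], at [t1] and at [t / s]. *)
Definition alexander_matrix_at (R : comNzRingType) (T : R) :
    'M[R]_(#|crossing L|, #|arcs L|) :=
  \matrix_(i, j) let c := enum_val i in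
    (1 - T) * (enum_val j == arc_of (over_in c))%:R
    + T * (enum_val j == arc_of (under_right c))%:R
    - (enum_val j == arc_of (under_left c))%:R.

Lemma map_alexander_matrix_at (R R' : comNzRingType) (f : {rmorphism R -> R'}) T :
  map_mx f (alexander_matrix_at T) = alexander_matrix_at (f T).
Proof.
apply/matrixP=> i j; rewrite !mxE /=.
by rewrite rmorphB rmorphD !rmorphM rmorphB rmorph1 !rmorph_nat.
Qed.

Lemma alexander_matrixE : alexander_matrix L = alexander_matrix_at t1.
Proof.
apply/row_matrixP=> i; rewrite rowK; apply/rowP=> j.
by rewrite !mxE.
Qed.

Lemma overpass_sym (x y : semiarc L) : overpass x y = overpass y x.
Proof. by apply: eq_existsb => c; rewrite orbC. Qed.

Lemma arc_of_eqP (x y : semiarc L) :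
  reflect (arc_of x = arc_of y) (connect (@overpass L) x y).
Proof.
apply: (iffP idP) => [x_y|/setP/(_ y)]; last by rewrite !inE connect0.
apply/setP=> z; rewrite !inE.
exact: (same_connect (sym_connect_sym overpass_sym) x_y).
Qed.

Lemma arc_over c : arc_of (over_in c) = arc_of (over_out c) :> {set semiarc L}.
Proof.
by apply/arc_of_eqP/connect1/existsP; exists c; rewrite !eqxx.
Qed.

(** Low and high refer to the Alexander numbers: the over strand descends at a
    positive crossing and ascends at a negative one. *)
Definition over_low (c : crossing L) : semiarc L :=
  if is_positive c then TR c else BR c.
Definition over_high (c : crossing L) : semiarc L :=
  if is_positive c then BL c else TL c.

Lemma arc_over_low c : arc_of (over_low c) = arc_of (over_in c).
Proof.
rewrite /over_low; have := arc_over c; rewrite /over_in /over_out.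
by case: is_positive => // ->.
Qed.

Lemma arc_over_high c : arc_of (over_high c) = arc_of (over_in c).
Proof.
rewrite /over_high; have := arc_over c; rewrite /over_in /over_out.
by case: is_positive => // ->.
Qed.

Lemma overpassE (x y : semiarc L) : overpass x y ->
  exists c, x = over_low c /\ y = over_high c \/ x = over_high c /\ y = over_low c.
Proof.
case/existsP=> c; rewrite /over_in /over_out => xy; exists c.
rewrite /over_low /over_high.
by case: is_positive xy => /orP[]/andP[/eqP-> /eqP->]; auto.
Qed.

Definition var_at (K : fieldType) (x : semiarc L) : 'rV[K]_#|semiarc L| :=
  delta_mx 0 (enum_rank x).

(** The two equations are told apart by the strand that they describe rather
    than by its side, so that one formula covers both signs. *)
Definition crossing_equation_at (K : fieldType) (s t : K) c (over : bool) :
    'rV[K]_#|semiarc L| :=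
  if over then var_at K (over_high c) - s *: var_at K (over_low c)
  else var_at K (under_left c)
       - (t *: var_at K (under_right c) + (s - t) *: var_at K (over_low c)).

Definition jablan_matrix_at (K : fieldType) (s t : K) :
    'M[K]_(#|{: crossing L * bool}|, #|semiarc L|) :=
  \matrix_i let e := enum_val i in
    crossing_equation_at s t e.1 (e.2 == is_positive e.1).

Lemma jablan_matrixE : jablan_matrix (pseudolink_of_link L) = jablan_matrix_at s t.
Proof.
apply/row_matrixP=> i; rewrite !rowK.
case: (enum_val i) => c b; rewrite /crossing_equation /crossing_equation_at /=.
by rewrite /over_high /over_low /under_left /under_right;
  case: is_positive; case: b.
Qed.

Variable w : crossing L * bool -> int.
Hypothesis w_numbering : forall c : crossing L,
  [/\ w (((Defs.next L)^-1)%g (c, true)) = w (c, true),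
      w (((Defs.next L)^-1)%g (c, false)) = w (c, true) + 1
    & w (c, false) = w (c, true) + 1].

Definition weight (x : semiarc L) : int := if x is inl e then w e else 0.

Lemma weight_over_high c : weight (over_high c) = weight (over_low c) + 1.
Proof.
have [e1 e2 e3] := w_numbering c.
by rewrite /over_high /over_low; case: is_positive; rewrite /= ?e1 ?e2 ?e3.
Qed.

Lemma weight_under_left c : weight (under_left c) = weight (over_low c) + 1.
Proof.
have [e1 e2 e3] := w_numbering c.
by rewrite /under_left /over_low; case: is_positive; rewrite /= ?e1 ?e2 ?e3.
Qed.

Lemma weight_under_right c : weight (under_right c) = weight (over_low c).
Proof.
have [e1 e2 e3] := w_numbering c.
by rewrite /under_right /over_low; case: is_positive; rewrite /= ?e1 ?e2 ?e3.
Qed.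

Variables (K : fieldType) (S : K -> Prop) (s t : K).
Hypotheses (S_sub : subring S) (s_neq0 : s != 0).
Hypotheses (S_s : forall k : int, S (s ^ k)) (S_t : S t).

Let J := jablan_matrix_at s t.
Let T : K := t / s.
Let A := alexander_matrix_at T.

Let var := var_at K.
Let arc (x : semiarc L) : 'rV[K]_#|arcs L| := \row_j (enum_val j == arc_of x)%:R.

Definition weighted_var (x : semiarc L) : 'rV[K]_#|semiarc L| :=
  s ^ (- weight x) *: var x.

Lemma weighted_over_equation c :
  s ^ (- weight (over_high c)) *: crossing_equation_at s t c true =
  weighted_var (over_high c) - weighted_var (over_low c).
Proof.
rewrite /crossing_equation_at scalerBr scalerA; congr (_ - _ *: _).
by rewrite weight_over_high expfz_pred.
Qed.

Lemma weighted_under_equation c :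
  s ^ (- weight (under_left c)) *: crossing_equation_at s t c false =
  weighted_var (under_left c) - (T *: weighted_var (under_right c) +
                                 (1 - T) *: weighted_var (over_low c)).
Proof.
rewrite /crossing_equation_at /weighted_var scalerBr scalerDr !scalerA.
rewrite weight_under_left weight_under_right.
set k := weight _.
have [-> ->] : s ^ (- (k + 1)) * t = T * s ^ (- k) /\
    s ^ (- (k + 1)) * (s - t) = (1 - T) * s ^ (- k).
  by rewrite -(expfz_pred k s_neq0) /T; split; field.
by [].
Qed.

Lemma alexander_row i (c := enum_val i) :
  row i A = (1 - T) *: arc (over_low c) + T *: arc (under_right c)
            - arc (under_left c).
Proof. by apply/rowP=> j; rewrite !mxE arc_over_low. Qed.

Definition in_row_space m n (B : 'M[K]_(m, n)) (v : 'rV[K]_n) : Prop :=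
  exists2 y : 'rV_m, over_subring S y & v = y *m B.

Lemma in_row_space_row m n (B : 'M[K]_(m, n)) i : in_row_space B (row i B).
Proof.
exists (delta_mx 0 i); last by rewrite -rowE.
by move=> j k; rewrite mxE; apply: subring_nat.
Qed.

Lemma in_row_space0 m n (B : 'M[K]_(m, n)) : in_row_space B 0.
Proof. by exists 0; rewrite ?mul0mx //; apply: over_subring0. Qed.

Lemma in_row_spaceD m n (B : 'M[K]_(m, n)) u v :
  in_row_space B u -> in_row_space B v -> in_row_space B (u + v).
Proof.
move=> [x Sx ->] [y Sy ->]; exists (x + y); rewrite ?mulmxDl //.
exact: over_subringD.
Qed.

Lemma in_row_spaceZ m n (B : 'M[K]_(m, n)) a u :
  S a -> in_row_space B u -> in_row_space B (a *: u).
Proof.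
move=> Sa [x Sx ->]; exists (a *: x); rewrite -?scalemxAl //.
exact: over_subringZ.
Qed.

Lemma in_row_spaceN m n (B : 'M[K]_(m, n)) u :
  in_row_space B u -> in_row_space B (- u).
Proof.
move=> Bu; rewrite -scaleN1r; apply: in_row_spaceZ => //.
by apply: (subringN S_sub); apply: subring1.
Qed.

Lemma in_row_spaceB m n (B : 'M[K]_(m, n)) u v :
  in_row_space B u -> in_row_space B v -> in_row_space B (u - v).
Proof. by move=> Bu Bv; apply/in_row_spaceD/in_row_spaceN. Qed.

Lemma rows_in_row_space m n p (A' : 'M[K]_(m, n)) (B : 'M[K]_(p, n)) :
    (forall i, in_row_space A' (row i B)) ->
  exists2 U : 'M_(p, m), over_subring S U & B = U *m A'.
Proof.
move=> B_A.
have ex i : exists y : 'rV_m, over_subring S y /\ row i B = y *m A'.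
  by have [y Sy By] := B_A i; exists y.
have [y y_P] := fin_all_exists ex.
exists (\matrix_i y i) => [i j|]; first by rewrite mxE; case: (y_P i).
by apply/row_matrixP=> i; rewrite row_mul rowK; case: (y_P i).
Qed.

Lemma crossing_equation_in_row_space c over :
  in_row_space J (crossing_equation_at s t c over).
Proof.
have := in_row_space_row J (enum_rank (c, over (+) ~~ is_positive c)).
rewrite rowK enum_rankK /=.
by case: over; case: is_positive.
Qed.

Lemma weighted_var_arc x y : arc_of x = arc_of y ->
  in_row_space J (weighted_var x - weighted_var y).
Proof.
move/arc_of_eqP=> /connectP[p path_p ->] {y}.
have over_step c : in_row_space J (weighted_var (over_high c) - weighted_var (over_low c)).
  rewrite -weighted_over_equation.
  exact/in_row_spaceZ/crossing_equation_in_row_space.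
elim: p x path_p => [|y p IHp] x /=; first by rewrite subrr => _; apply: in_row_space0.
case/andP=> /overpassE[c xy] /IHp y_p.
rewrite -[weighted_var x](subrK (weighted_var y)) -addrA; apply: in_row_spaceD => //.
by case: xy => -[-> ->] //; rewrite -opprB; apply: in_row_spaceN.
Qed.

(** Dividing the variable of a semiarc by the power of [s] given by its Alexander
    number turns the over equations into equalities along the arcs
    and the under equations into the Alexander relations at [t / s], so both
    matrices present the same module. *)
Lemma jablan_alexander_minor_ideal k x :
    (k <= #|semiarc L|)%N -> (k <= #|arcs L|)%N ->
  ideal_generated_by S (minor (#|arcs L| - k) A) x <->
  ideal_generated_by S (minor (#|semiarc L| - k) J) x.
Proof.
move=> le_k_semiarc le_k_arcs.
have ST : S T by apply: (subringM S_sub) => //; rewrite -exprN1; apply: (S_s (-1)).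
have S1T : S (1 - T) by apply: (subringD S_sub); [apply: subring1|apply: subringN].
have ex_rep (j : 'I_#|arcs L|) : exists x : semiarc L, arc_of x = enum_val j.
  by have /imsetP[y _ ->] := enum_valP j; exists y.
have [rep repP] := fin_all_exists ex_rep.
pose P := \matrix_(i < #|semiarc L|) (s ^ weight (enum_val i) *: arc (enum_val i)).
pose Q := \matrix_(j < #|arcs L|) weighted_var (rep j).
have arc_rep j : arc (rep j) = delta_mx 0 j.
  by apply/rowP=> l; rewrite !mxE repP (inj_eq enum_val_inj) eqxx eq_sym.
have varP y : var y *m P = s ^ weight y *: arc y.
  by rewrite -rowE rowK enum_rankK.
have weightedP y : weighted_var y *m P = arc y.
  rewrite -scalemxAl varP scalerA -expfzDr // addNr expr0z scale1r.
  by [].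
have arcQ y : in_row_space J (arc y *m Q - weighted_var y).
  have arc_in : arc_of y \in arcs L by apply: imset_f.
  pose j := enum_rank_in arc_in (arc_of y).
  have yj : arc_of y = arc_of (rep j) by rewrite repP enum_rankK_in.
  have ->: arc y = arc (rep j) by apply/rowP=> l; rewrite !mxE yj.
  by rewrite arc_rep -rowE rowK; apply: weighted_var_arc.
have S_arc y : over_subring S (arc y).
  by move=> i j; rewrite mxE; apply: subring_nat.
have S_var y : over_subring S (var y).
  by move=> i j; rewrite mxE; apply: subring_nat.
have SA : over_subring S A.
  move=> i j; rewrite mxE.
  by apply: (subringD S_sub); [apply: (subringD S_sub)|apply: (subringN S_sub)];
    try apply: (subringM S_sub) => //; apply: subring_nat.
have SJ : over_subring S J.
  move=> i j; rewrite mxE /crossing_equation_at.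
  set c := (enum_val i).1; case: (_ == _).
    by apply: over_subringD => //; apply: over_subringN => //; apply: over_subringZ => //;
      apply: (S_s 1).
  apply: over_subringD => //; apply: over_subringN => //; apply: over_subringD => //;
    apply: over_subringZ => //.
  by apply: (subringD S_sub); [apply: (S_s 1)|apply: (subringN S_sub)].
have SP : over_subring S P.
  by move=> i j; rewrite mxE; apply: over_subringZ.
have SQ : over_subring S Q.
  by move=> i j; rewrite mxE; apply: over_subringZ.
have [U SU JP] : exists2 U, over_subring S U & J *m P = U *m A.
  apply: rows_in_row_space => i; rewrite row_mul rowK.
  case: (enum_val i) => c b /=; rewrite /crossing_equation_at; case: (_ == _).
    rewrite mulmxBl -scalemxAl !varP weight_over_high expfz_succ // scalerA.
    have ->: arc (over_high c) = arc (over_low c).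
      by apply/rowP=> l; rewrite !mxE arc_over_low arc_over_high.
    by rewrite subrr; apply: in_row_space0.
  have -> : (var_at K (under_left c) - (t *: var_at K (under_right c)
     + (s - t) *: var_at K (over_low c))) *m P =
     - s ^ (weight (under_left c)) *: row (enum_rank c) A.
    rewrite alexander_row enum_rankK mulmxBl mulmxDl -!scalemxAl !varP.
    rewrite scaleNr -scalerN opprB [X in _ - X]addrC scalerBr scalerDr !scalerA.
    rewrite weight_under_left weight_under_right expfz_succ //.
    move: (s ^ _) => a.
    have [-> ->] : s * a * T = t * a /\ s * a * (1 - T) = (s - t) * a.
      by rewrite /T; split; field.
    by [].
  apply: in_row_spaceZ; last exact: in_row_space_row.
  exact: (subringN S_sub).
have [V SV AQ] : exists2 V, over_subring S V & A *m Q = V *m J.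
  apply: rows_in_row_space => i; rewrite row_mul alexander_row.
  set c := enum_val i; rewrite mulmxBl mulmxDl -!scalemxAl.
  rewrite -[arc (over_low c) *m Q](subrK (weighted_var (over_low c))).
  rewrite -[arc (under_right c) *m Q](subrK (weighted_var (under_right c))).
  rewrite -[arc (under_left c) *m Q](subrK (weighted_var (under_left c))).
  have -> : forall (M : lmodType K) (a b : K) (u v x u' v' x' : M),
    a *: (u + u') + b *: (v + v') - (x + x') =
    a *: u + b *: v - x - (x' - (b *: v' + a *: u')).
    move=> M a b u v z u' v' z'.
    by rewrite !scalerDr addrACA opprD [LHS]addrACA opprB [b *: v' + _]addrC.
  apply: in_row_spaceB.
    by apply: in_row_spaceB => //; apply: in_row_spaceD; apply: in_row_spaceZ.
  rewrite -weighted_under_equation.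
  exact/in_row_spaceZ/crossing_equation_in_row_space.
have [W SW PQ] : exists2 W, over_subring S W & 1%:M - P *m Q = W *m J.
  apply: rows_in_row_space => i; rewrite linearB /= row1 row_mul rowK.
  set y := enum_val i; rewrite -scalemxAl.
  have -> : delta_mx 0 i = s ^ weight y *: weighted_var y.
    rewrite scalerA -expfzDr // subrr expr0z scale1r.
    by rewrite /var /var_at enum_valK.
  rewrite -scalerBr -opprB; apply: in_row_spaceZ => //.
  exact: in_row_spaceN.
have QP : 1%:M - Q *m P = 0 *m A.
  apply/row_matrixP=> j; rewrite mul0mx row0 linearB /= row1 row_mul rowK.
  by rewrite weightedP arc_rep subrr.
apply: (minor_ideal_isomorphic_cokernel S_sub _ SA SJ SP SQ SU SV SW _ JP AQ PQ QP) => //.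
exact: over_subring0.
Qed.

End JablanAlexander.

(** * Divisibility in Z[T] *)

Definition divides (R : comNzRingType) (a b : R) : Prop := exists c, b = c * a.

Definition is_gcd (R : comNzRingType) (a b g : R) : Prop :=
  [/\ divides g a, divides g b
    & forall d, divides d a -> divides d b -> divides d g].

Lemma divides_mull (R : comNzRingType) (a b c : R) : divides a b -> divides a (c * b).
Proof. by case=> d ->; exists (c * d); rewrite mulrA. Qed.

Lemma divides_trans (R : comNzRingType) (a b c : R) :
  divides a b -> divides b c -> divides a c.
Proof. by move=> [d ->] [e ->]; exists (e * d); rewrite mulrA. Qed.

Lemma zcontents_divides (d p : {poly int}) :
  divides d p -> (zcontents d %| zcontents p)%Z.
Proof. by case=> r ->; rewrite zcontentsM dvdz_mull. Qed.

(** The primitive part of a greatest common divisor over [Q], times the greatest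
    common divisor of the contents. *)
Lemma gcd_poly_int (p q : {poly int}) : exists g, is_gcd p q g.
Proof.
pose h := gcdp p q; pose c := gcdz (zcontents p) (zcontents q).
have dvd_c r : (h %| r)%R -> (c %| zcontents r)%Z ->
    divides (c *: zprimitive h) r.
  case/dvdpP_int=> r' {1 2}->.
  have [-> _|h_neq0] := eqVneq h 0.
    by exists 0; rewrite zprimitive0 !mul0r.
  rewrite zcontentsM zcontents_primitive h_neq0 mul1r => /dvdzP[e c_e].
  exists (e *: zprimitive r'); rewrite -scalerAl -scalerAr scalerA -c_e.
  by rewrite [in LHS](zpolyEprim r') -scalerAr mulrC.
exists (c *: zprimitive h); split.
- by apply: dvd_c; [apply: dvdp_gcdl|apply: dvdz_gcdl].
- by apply: dvd_c; [apply: dvdp_gcdr|apply: dvdz_gcdr].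
move=> d d_p d_q.
have : (d %| h)%R.
  by rewrite dvdp_gcd; case: d_p d_q => [r ->] [r' ->]; rewrite !dvdp_mull.
case/dvdpP_int=> r h_r.
have /dvdzP[e c_e] : (zcontents d %| c)%Z.
  by rewrite dvdz_gcd !zcontents_divides.
exists (e *: zprimitive r); rewrite h_r zprimitiveM zprimitive_id c_e.
by rewrite [in RHS](zpolyEprim d) -scalerAl -scalerAr scalerA [zprimitive r * _]mulrC.
Qed.

(** A greatest common divisor of [w * p] and [w * q] is [w * k] for some common
    divisor [k] of [p] and [q]. *)
Lemma divides_mul_gcd (d w p q g : {poly int}) :
  is_gcd p q g -> divides d (w * p) -> divides d (w * q) -> divides d (w * g).
Proof.
move=> [_ _ g_max] d_p d_q.
have [->|w_neq0] := eqVneq w 0; first by exists 0; rewrite !mul0r.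
have [G [[a w_p] [b w_q] G_max]] := gcd_poly_int (w * p) (w * q).
have [k G_k] : divides w G by apply: G_max; [exists p|exists q]; rewrite mulrC.
apply: divides_trans (G_max _ d_p d_q) _.
have [] := g_max k.
- by exists a; apply: (mulfI w_neq0); rewrite w_p G_k; ring.
- by exists b; apply: (mulfI w_neq0); rewrite w_q G_k; ring.
by move=> c ->; exists c; rewrite G_k; ring.
Qed.

(** The second clause says that [g] is a greatest common divisor of [l] in
    every ring of fractions of [Z[T]]. *)
Definition is_localized_gcd (l : seq {poly int}) (g : {poly int}) : Prop :=
  (forall p, p \in l -> divides g p) /\
  (forall W : {poly int} -> Prop, W 1 -> (forall v w, W v -> W w -> W (v * w)) ->
   forall d, (forall p, p \in l -> exists2 w, W w & divides d (w * p)) ->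
   exists2 w, W w & divides d (w * g)).

(** The greatest common divisor of finitely many polynomials stays one after
    localization: a common divisor in a ring of fractions divides the given
    polynomials up to denominators, and a common denominator can be pulled
    out of a greatest common divisor. *)
Lemma localized_gcd (l : seq {poly int}) : exists g, is_localized_gcd l g.
Proof.
elim: l => [|p l [g [g_dvd g_loc]]].
  by exists 0; split=> // W W1 _ d _; exists 1 => //; exists 0; rewrite mul0r mulr0.
have [h [h_p h_g h_max]] := gcd_poly_int p g; exists h; split=> [q|W W1 WM d d_dvd].
  by rewrite inE => /orP[/eqP->//|/g_dvd]; apply: divides_trans h_g.
have [|w Ww d_g] := g_loc W W1 WM d.
  by move=> q q_l; apply: d_dvd; rewrite inE q_l orbT.
have [v Wv d_p] := d_dvd p (mem_head _ _).
exists (v * w); first exact: WM.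
apply: (divides_mul_gcd (And3 h_p h_g h_max)).
  by rewrite mulrAC mulrC; apply: divides_mull.
by rewrite -mulrA; apply: divides_mull.
Qed.

Section PrimeFactors.
Variable R : idomainType.

Definition prime_element (a : R) : Prop :=
  a != 0 /\ forall x y, divides a (x * y) -> divides a x \/ divides a y.

(** The prime factors [a] of the product are shared out between [x] and [y]. *)
Lemma split_prime_power a n (x y w : R) : prime_element a -> x * y = a ^+ n * w ->
  exists i j x' y', [/\ x = a ^+ i * x', y = a ^+ j * y' & x' * y' = w].
Proof.
move=> [a_neq0 a_prime]; elim: n x y => [|n IHn] x y xy.
  by exists 0%N, 0%N, x, y; rewrite !mul1r xy mul1r.
have : divides a (x * y) by exists (a ^+ n * w); rewrite xy exprSr mulrAC.
case/a_prime=> -[z Dz]; move: xy; rewrite Dz.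
  rewrite mulrAC exprSr [a ^+ n * a * w]mulrAC => /(mulIf a_neq0)/IHn.
  move=> [i [j [x' [y' [-> -> <-]]]]].
  by exists i.+1, j, x', y'; rewrite exprSr mulrAC.
rewrite mulrA exprSr [a ^+ n * a * w]mulrAC => /(mulIf a_neq0)/IHn.
move=> [i [j [x' [y' [-> -> <-]]]]].
by exists i, j.+1, x', y'; rewrite exprSr mulrAC.
Qed.

Lemma prime_XsubC (a : R) : forall x y : {poly R},
  divides ('X - a%:P) (x * y) -> divides ('X - a%:P) x \/ divides ('X - a%:P) y.
Proof.
move=> x y [c xy]; have : root (x * y) a by apply/factor_theorem; exists c.
by rewrite rootM => /orP[]/factor_theorem; [left|right].
Qed.

End PrimeFactors.

Lemma prime_elementX (R : idomainType) : prime_element ('X : {poly R}).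
Proof.
split=> [|x y]; first by rewrite polyX_eq0.
by rewrite -['X]subr0; apply: prime_XsubC.
Qed.

Lemma prime_element_1X : prime_element (1 + 'X : {poly int}).
Proof.
have -> : 1 + 'X = 'X - (-1)%:P :> {poly int} by rewrite polyCN opprK addrC.
by split; [rewrite polyXsubC_eq0|apply: prime_XsubC].
Qed.

(** Gauss's lemma: contents multiply. *)
Lemma prime_element_2 : prime_element (2%:R : {poly int}).
Proof.
have two : 2%:R = 2%:Z%:P :> {poly int} by rewrite -(natz 2) rmorph_nat.
have dvd2 x : divides 2%:R x <-> (2%:Z %| zcontents x)%Z.
  rewrite two; split=> [[c ->]|/dvdzP[c x_c]].
    by rewrite mulrC mul_polyC zcontentsZ dvdz_mulr.
  exists (c *: zprimitive x); rewrite mulrC mul_polyC scalerA mulrC -x_c.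
  exact: zpolyEprim.
split=> [|x y]; first by rewrite two polyC_eq0.
rewrite !dvd2 zcontentsM !dvdzE abszM Euclid_dvdM //.
by case/orP; [left|right].
Qed.

(** The elements of [Z[T]] that are inverted by the substitution [s = 1],
    [t = T] in [LambdaJ]. *)
Definition inverted (i k l : nat) : {poly int} := 2%:R ^+ i * 'X ^+ k * (1 + 'X) ^+ l.

Lemma invertedM i k l i' k' l' :
  inverted i k l * inverted i' k' l' = inverted (i + i') (k + k') (l + l').
Proof. by rewrite /inverted !exprD; ring. Qed.

Lemma inverted_neq0 i k l : inverted i k l != 0.
Proof.
by rewrite /inverted !mulf_neq0 // expf_neq0 //;
  case: prime_element_2 (@prime_elementX int) prime_element_1X => + _ [+ _] [+ _].
Qed.

Lemma divisor_of_inverted x y i k l : x * y = inverted i k l ->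
  exists (b : bool) i' k' l', x = (-1) ^+ b * inverted i' k' l'.
Proof.
rewrite /inverted -mulrA => /(split_prime_power prime_element_2).
move=> [i1 [_ [x1 [y1 [-> _]]]]].
case/(split_prime_power (@prime_elementX int)) => k1 [_ [x2 [y2 [-> _]]]].
rewrite -[RHS]mulr1 => /(split_prime_power prime_element_1X).
move=> [l1 [_ [x3 [y3 [-> _ x3y3]]]]].
have : x3 \is a GRing.unit by apply/unitrPr; exists y3.
rewrite poly_unitE => /andP[/size_poly1P[c c_neq0 ->]]; rewrite coefC /=.
case/orP=> /eqP->.
  by exists false, i1, k1, l1; rewrite /inverted; ring.
by exists true, i1, k1, l1; rewrite /inverted polyCN; ring.
Qed.

(** * The ring LambdaJ *)

Lemma poly_st_eq0 P : (poly_st P == 0) = (P == 0).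
Proof. by rewrite /poly_st tofrac_eq0. Qed.

Lemma poly_stD P Q : poly_st (P + Q) = poly_st P + poly_st Q.
Proof. exact: tofracD. Qed.

Lemma poly_stM P Q : poly_st (P * Q) = poly_st P * poly_st Q.
Proof. exact: tofracM. Qed.

Lemma poly_stN P : poly_st (- P) = - poly_st P.
Proof. exact: tofracN. Qed.

Lemma poly_st1 : poly_st 1 = 1.
Proof. exact: tofrac1. Qed.

Lemma poly_stX P n : poly_st (P ^+ n) = poly_st P ^+ n.
Proof. exact: tofracXn. Qed.

Lemma poly_st_nat n : poly_st n%:R = n%:R.
Proof. by rewrite /poly_st tofracMn tofrac1. Qed.

Lemma mpoly_neq0 (P : {mpoly int[2]}) (x : 'I_2 -> int) : P.@[x] != 0 -> P != 0.
Proof. by apply: contraNneq => ->; rewrite meval0. Qed.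

Lemma s_neq0 : s != 0.
Proof. by rewrite poly_st_eq0 (@mpoly_neq0 _ (fun=> 1)) // mevalXU. Qed.

Lemma t_neq0 : t != 0.
Proof. by rewrite poly_st_eq0 (@mpoly_neq0 _ (fun=> 1)) // mevalXU. Qed.

Lemma st_neq0 : s + t != 0.
Proof.
by rewrite -poly_stD poly_st_eq0 (@mpoly_neq0 _ (fun=> 1)) // mevalD !mevalXU.
Qed.

Lemma two_neq0 : 2%:R != 0 :> Qst.
Proof. by rewrite -poly_st_nat poly_st_eq0 (@mpoly_neq0 _ (fun=> 1)) // rmorph_nat. Qed.

(** The denominators of [LambdaJ], as polynomials. *)
Definition denominator (i j k l : nat) : {mpoly int[2]} :=
  2%:R ^+ i * 'X_ord0 ^+ j * 'X_ord_max ^+ k * ('X_ord0 + 'X_ord_max) ^+ l.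

Lemma poly_st_denominator i j k l : poly_st (denominator i j k l) =
  2%:R ^+ i * s ^+ j * t ^+ k * (s + t) ^+ l.
Proof. by rewrite /denominator !poly_stM !poly_stX poly_stD poly_st_nat. Qed.

Lemma denominator_neq0 i j k l : poly_st (denominator i j k l) != 0.
Proof.
rewrite poly_st_denominator; apply: mulf_neq0; last exact: (expf_neq0 _ st_neq0).
apply: mulf_neq0; last exact: (expf_neq0 _ t_neq0).
by apply: mulf_neq0; [exact: (expf_neq0 _ two_neq0)|exact: (expf_neq0 _ s_neq0)].
Qed.

Lemma denominatorM i j k l i' j' k' l' :
  denominator (i + i') (j + j') (k + k') (l + l') =
  denominator i j k l * denominator i' j' k' l'.
Proof. by rewrite /denominator !exprD; ring. Qed.

Lemma LambdaJP x : LambdaJ x <->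
  exists P i j k l, x = poly_st P / poly_st (denominator i j k l).
Proof.
by split=> -[P [i [j [k [l ->]]]]]; exists P, i, j, k, l;
  rewrite poly_st_denominator.
Qed.

Lemma LambdaJ_poly P : LambdaJ (poly_st P).
Proof. by exists P, 0, 0, 0, 0; rewrite !expr0 !mulr1 divr1. Qed.

Lemma LambdaJ_denominator i j k l : LambdaJ (poly_st (denominator i j k l))^-1.
Proof.
by apply/LambdaJP; exists 1, i, j, k, l; rewrite poly_st1 mul1r.
Qed.

Lemma subring_LambdaJ : subring LambdaJ.
Proof.
split.
- by rewrite -poly_st1; apply: LambdaJ_poly.
- move=> _ /LambdaJP[P [i [j [k [l ->]]]]]; apply/LambdaJP.
  by exists (- P), i, j, k, l; rewrite poly_stN mulNr.
- move=> _ _ /LambdaJP[P [i [j [k [l ->]]]]] /LambdaJP[Q [i' [j' [k' [l' ->]]]]].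
  apply/LambdaJP; exists (P * denominator i' j' k' l' + Q * denominator i j k l).
  exists (i + i')%N, (j + j')%N, (k + k')%N, (l + l')%N.
  rewrite denominatorM.
  move: (denominator_neq0 i j k l) (denominator_neq0 i' j' k' l').
  move: (denominator _ _ _ _) (denominator _ _ _ _) => D D' D0 D0'.
  by rewrite addf_div // poly_stD !poly_stM.
move=> _ _ /LambdaJP[P [i [j [k [l ->]]]]] /LambdaJP[Q [i' [j' [k' [l' ->]]]]].
apply/LambdaJP; exists (P * Q).
exists (i + i')%N, (j + j')%N, (k + k')%N, (l + l')%N.
rewrite denominatorM; move: (denominator _ _ _ _) (denominator _ _ _ _) => D D'.
by rewrite !poly_stM invfM mulrACA.
Qed.

Lemma LambdaJ_sX (k : int) : LambdaJ (s ^ k).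
Proof.
case: k => k; first by rewrite -[s ^ _]/(s ^+ k) -poly_stX; apply: LambdaJ_poly.
rewrite NegzE -exprnN -[s ^+ _]mul1r -[1 * _]mulr1 -[X in X * _]mulr1.
have := LambdaJ_denominator 0 k.+1 0 0.
by rewrite poly_st_denominator !expr0 mul1r !mulr1.
Qed.

(** * Homogeneous polynomials in two variables *)

Lemma monomial_factor (R : idomainType) (p q : {poly R}) (c : R) n : c != 0 ->
  p * q = c *: 'X^n ->
  exists d e i j, [/\ p = d *: 'X^i, q = e *: 'X^j & d * e = c].
Proof.
move=> c_neq0; rewrite -mul_polyC [_%:P * _]mulrC => /(split_prime_power (@prime_elementX R)).
move=> [i [j [p' [q' [-> -> pq]]]]].
have /eqP : size (p' * q') == 1%N by rewrite pq size_polyC c_neq0.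
have pq_neq0 : p' * q' != 0 by rewrite pq polyC_eq0.
move: pq_neq0; rewrite mulf_eq0 negb_or => /andP[p'0 q'0].
rewrite size_mul // => size_pq.
have size_p : (size p' <= 1)%N.
  move: size_pq q'0; rewrite -size_poly_gt0; case: (size q') => // k.
  by rewrite addnS /= => <-; rewrite leq_addr.
have size_q : (size q' <= 1)%N.
  move: size_pq p'0; rewrite -size_poly_gt0; case: (size p') => // k.
  by rewrite addSn /= => <-; rewrite leq_addl.
exists p'`_0, q'`_0, i, j.
have [Dp Dq] := (size1_polyC size_p, size1_polyC size_q); split.
- by rewrite {1}Dp mulrC mul_polyC.
- by rewrite {1}Dq mulrC mul_polyC.
by apply: polyC_inj; rewrite polyCM -Dp -Dq.
Qed.

(** The substitution [s = z], [t = T z]: the coefficient of [z ^ d] is the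
    homogeneous part of degree [d], read in the ratio [T] of the variables. *)
Definition by_degree : {rmorphism {mpoly int[2]} -> {poly {poly int}}} :=
  mmap (polyC \o polyC) (fun i : 'I_2 => if i == ord0 then 'X else 'X%:P * 'X).

Lemma by_degree_s : by_degree 'X_ord0 = 'X.
Proof. by rewrite /by_degree /= mmapX mmap1U eqxx. Qed.

Lemma by_degree_t : by_degree 'X_ord_max = 'X%:P * 'X.
Proof. by rewrite /by_degree /= mmapX mmap1U. Qed.

Lemma by_degreeC c : by_degree c%:MP = c%:P%:P.
Proof. by rewrite /by_degree /= mmapC. Qed.

Lemma mdeg2 (m : 'X_{1..2}) : mdeg m = (m ord0 + m ord_max)%N.
Proof.
rewrite mdegE big_ord_recl big_ord1; congr (_ + m _)%N.
exact: val_inj.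
Qed.

Lemma mpolyX2 (m : 'X_{1..2}) :
  'X_[m] = 'X_ord0 ^+ m ord0 * 'X_ord_max ^+ m ord_max :> {mpoly int[2]}.
Proof.
rewrite mpolyXE_id big_ord_recl big_ord1.
by have -> : lift ord0 ord0 = ord_max :> 'I_2 by apply: val_inj.
Qed.

Lemma by_degreeX (m : 'X_{1..2}) :
  by_degree 'X_[m] = ('X^(m ord_max))%:P * 'X^(mdeg m).
Proof.
rewrite mpolyX2 rmorphM !rmorphXn by_degree_s by_degree_t /= exprMn mdeg2 exprD.
by ring.
Qed.

Lemma by_degreeE P :
  by_degree P = \sum_(m <- msupp P) ((P@_m)%:P * 'X^(m ord_max))%:P * 'X^(mdeg m).
Proof.
rewrite {1}[P]mpolyE rmorph_sum; apply: eq_bigr => m _.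
by rewrite -mul_mpolyC rmorphM by_degreeC by_degreeX rmorphM mulrA.
Qed.

Lemma coef_by_degree P m : (by_degree P)`_(mdeg m)`_(m ord_max) = P@_m.
Proof.
have coef_term (c : int) (m' : 'X_{1..2}) :
    ((c%:P * 'X^(m' ord_max))%:P * 'X^(mdeg m'))`_(mdeg m)`_(m ord_max) =
    c * (m' == m)%:R.
  rewrite coefCM coefXn; have [eq_deg|neq_deg] := eqVneq (mdeg m) (mdeg m').
    rewrite mulr1 coefCM coefXn; congr (_ * _%:R).
    have [eq_t|neq_t] := eqVneq (m ord_max) (m' ord_max); last first.
      by case: (eqVneq m' m) neq_t => [->|//]; rewrite eqxx.
    suff -> : m' = m by rewrite eqxx.
    apply/mnmP=> i; have [->|neq_i] := eqVneq i ord_max; first exact/esym.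
    have -> : i = ord0.
      by apply: val_inj; case: i neq_i => -[|[|]].
    by move: eq_deg; rewrite !mdeg2 eq_t => /addIn.
  by rewrite mulr0 coef0; case: (eqVneq m' m) neq_deg => [->|_ _];
    rewrite ?eqxx ?mulr0.
rewrite by_degreeE !coef_sum.
under eq_bigr do rewrite coef_term.
have [m_P|m_notP] := boolP (m \in msupp P).
  rewrite (bigD1_seq m) //= eqxx mulr1 big1 ?addr0 // => m' /negPf->.
  by rewrite mulr0.
rewrite (memN_msupp_eq0 m_notP) big_seq big1 // => m' m'_P.
by case: (eqVneq m' m) m'_P m_notP => [->->//|_ _ _]; rewrite mulr0.
Qed.

Lemma homogeneous_of_by_degree P c d : by_degree P = c *: 'X^d -> P \is d.-homog.
Proof.
move=> P_c; apply/dhomogP=> m; rewrite mcoeff_msupp -coef_by_degree P_c.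
rewrite coefZ coefXn; case: (eqVneq (mdeg m) d) => [//|_].
by rewrite mulr0 coef0 eqxx.
Qed.

Lemma at_s1_by_degree P : at_s1 P = (by_degree P).[1].
Proof.
rewrite by_degreeE horner_sum; apply: eq_bigr => m _.
rewrite hornerCM hornerXn expr1n mulr1; congr (_ * _).
rewrite /mmap1 big_ord_recl big_ord1 /= expr1n mul1r.
by have -> : lift ord0 ord0 = ord_max :> 'I_2 by apply: val_inj.
Qed.

Definition at_ratio : {rmorphism {poly int} -> Qst} :=
  horner_eval (t / s) \o map_poly intr.

Lemma at_ratioX : at_ratio 'X = t / s.
Proof. by rewrite /at_ratio /= map_polyX /horner_eval hornerX. Qed.

Lemma ratio_power (K : fieldType) (a b : K) i j : a != 0 ->
  (b / a) ^+ j * a ^+ (i + j) = a ^+ i * b ^+ j.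
Proof.
by move=> a_neq0; rewrite exprD mulrCA -exprMn divfK.
Qed.

Lemma poly_stZ c P : poly_st (c *: P) = c%:~R * poly_st P.
Proof.
rewrite -mul_mpolyC poly_stM; congr (_ * _).
by rewrite -{1}[c]intz rmorph_int /poly_st rmorph_int.
Qed.

Lemma at_ratioC c : at_ratio c%:P = c%:~R.
Proof. by rewrite /at_ratio /= map_polyC /horner_eval hornerC. Qed.

Lemma horner_map_monomial (R R' : comNzRingType) (f : {rmorphism R -> R'}) c n x :
  (map_poly f (c%:P * 'X^n)).[x] = f c * x ^+ n.
Proof. by rewrite rmorphM /= map_polyC map_polyXn hornerCM hornerXn. Qed.

Lemma at_ratioM p q : at_ratio (p * q) = at_ratio p * at_ratio q.
Proof. exact: rmorphM. Qed.

Lemma at_ratioXn p n : at_ratio (p ^+ n) = at_ratio p ^+ n.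
Proof. exact: rmorphXn. Qed.

Lemma poly_st_by_degree P : poly_st P = (map_poly at_ratio (by_degree P)).[s].
Proof.
rewrite by_degreeE rmorph_sum horner_sum.
transitivity (\sum_(m <- msupp P) poly_st (P@_m *: 'X_[m])).
  by rewrite {1}[P]mpolyE; apply: (rmorph_sum (@tofrac {mpoly int[2]})).
apply: eq_bigr => m _; rewrite poly_stZ mpolyX2 poly_stM !poly_stX.
rewrite horner_map_monomial at_ratioM at_ratioXn at_ratioC at_ratioX mdeg2 -mulrA.
by congr (_ * _); rewrite (ratio_power _ _ _ s_neq0).
Qed.

Lemma poly_st_monomial P c d : by_degree P = c *: 'X^d ->
  poly_st P = at_ratio c * s ^+ d.
Proof.
move=> P_c; by rewrite poly_st_by_degree P_c -mul_polyC horner_map_monomial.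
Qed.

Definition homogenize (p : {poly int}) : {mpoly int[2]} :=
  \sum_(i < size p) p`_i *: ('X_ord_max ^+ i * 'X_ord0 ^+ (size p - i)).

Lemma by_degree_homogenize p : by_degree (homogenize p) = p *: 'X^(size p).
Proof.
have p_sum : p%:P = \sum_(i < size p) ((p`_i)%:P * 'X^i)%:P.
  rewrite -rmorph_sum -{1}[p]coefK poly_def; congr _%:P.
  by apply: eq_bigr => i _; rewrite mul_polyC.
rewrite rmorph_sum -mul_polyC p_sum mulr_suml.
apply: eq_bigr => i _; rewrite -mul_mpolyC rmorphM by_degreeC.
rewrite rmorphM !rmorphXn by_degree_s by_degree_t exprMn -mulrA -exprD.
by rewrite subnKC ?(ltnW (ltn_ord i)) // mulrA -!rmorphXn -rmorphM.
Qed.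

Lemma poly_st_homogenize p : poly_st (homogenize p) = at_ratio p * s ^+ size p.
Proof. exact/poly_st_monomial/by_degree_homogenize. Qed.

Lemma by_degree_denominator i j k l :
  by_degree (denominator i j k l) = inverted i k l *: 'X^(j + k + l).
Proof.
rewrite /denominator /inverted !rmorphM !rmorphXn rmorph_nat.
rewrite [by_degree (_ + _)]rmorphD by_degree_s by_degree_t -mul_polyC.
rewrite !polyCM !rmorphXn /= polyC_natr polyCD polyC1.
have -> : 'X + 'X%:P * 'X = (1 + 'X%:P) * 'X :> {poly {poly int}} by ring.
by rewrite !exprMn !exprD; ring.
Qed.

(** * Generators of the elementary ideals *)

Section PrincipalIdeals.
Variables (K : fieldType) (S : K -> Prop).
Hypothesis S_sub : subring S.

Lemma generates_smallest_principal_idealP (X : K -> Prop) d : S d ->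
    (forall x, X x -> principal_ideal S d x) ->
    (forall e, S e -> (forall x, X x -> principal_ideal S e x) ->
       principal_ideal S e d) ->
  generates_smallest_principal_ideal S (ideal_generated_by S X) d.
Proof.
move=> Sd X_d d_min; split=> // [|e Se X_e].
  apply: ideal_min => // [|x y [a Sa ->] [b Sb ->]|a x Sa [b Sb ->]].
  - by exists 0; rewrite ?mul0r //; apply: subring0.
  - by exists (a + b); rewrite ?mulrDl //; apply: subringD.
  - by exists (a * b); rewrite ?mulrA //; apply: subringM.
have [a Sa d_a] : principal_ideal S e d.
  by apply: d_min => // x Xx; apply/X_e/ideal_gen.
by move=> _ [b Sb ->]; exists (b * a); rewrite ?d_a ?mulrA //; apply: subringM.
Qed.

Lemma eq_generates_smallest_principal_ideal (I J : K -> Prop) d :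
    (forall x, I x <-> J x) ->
  generates_smallest_principal_ideal S I d ->
  generates_smallest_principal_ideal S J d.
Proof.
move=> IJ [Sd I_d d_min]; split=> // [x /IJ/I_d//|e Se J_e].
by apply: d_min => // x /IJ/J_e.
Qed.

Lemma generators_associated (I : K -> Prop) d e :
    generates_smallest_principal_ideal S I d ->
    generates_smallest_principal_ideal S I e ->
  exists a b, [/\ S a, S b, d = a * e & e = b * d].
Proof.
move=> [Sd I_d d_min] [Se I_e e_min].
have self x : principal_ideal S x x by exists 1; rewrite ?mul1r //; apply: subring1.
have [a Sa d_e] := d_min _ Se I_e _ (self d).
have [b Sb e_d] := e_min _ Sd I_d _ (self e).
by exists a, b.
Qed.

End PrincipalIdeals.

(** One list of minors over [Z[T]] serves for [t1] and for [t / s], so that both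
    polynomials come from the same greatest common divisor. *)
Lemma codim1_minors_enum m n (A : 'M[{poly int}]_(m, n)) :
  exists l : seq {poly int}, forall (K : fieldType)
    (f : {rmorphism {poly int} -> K}) x,
  codim1_minor (map_mx f A) x <-> exists2 p, p \in l & x = f p.
Proof.
case: n A => [|n] A.
  by exists [::] => K f x; split=> [[k [g [h []]]]|[]].
pose I := ({ffun 'I_n -> 'I_m} * {ffun 'I_n -> 'I_n.+1})%type.
pose l := [seq \det (mxsub fg.1 fg.2 A) |
  fg : I in [pred fg : I | injectiveb fg.1 && injectiveb fg.2]].
exists l => K f x; split=> [[k [g [h [[eq_k] inj_g inj_h ->]]]]|[p]].
  rewrite {}eq_k in g h inj_g inj_h *.
  exists (\det (mxsub g h A)); last by rewrite -det_map_mx map_mxsub.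
  apply/imageP; exists (finfun g, finfun h).
    by apply/andP; split; apply/injectiveP=> i j; rewrite !ffunE; [apply: inj_g|apply: inj_h].
  by congr (\det _); apply/matrixP=> i j; rewrite !mxE !ffunE.
case/imageP=> -[g h] /andP[/injectiveP inj_g /injectiveP inj_h] -> ->.
by exists n, g, h; split; rewrite // -det_map_mx map_mxsub.
Qed.

Lemma clear_denominators (K : fieldType) (x a b u v : K) : u != 0 -> v != 0 ->
  x = a / u * (b / v) -> u * v * x = a * b.
Proof. by move=> u_neq0 v_neq0 ->; field; rewrite ?u_neq0 ?v_neq0. Qed.

Lemma restore_denominators (K : fieldType) (x a b u v : K) : u != 0 -> v != 0 ->
  u * x = a * b -> x = a * v / u * (b / v).
Proof.
move=> u_neq0 v_neq0 ux; apply: (mulfI u_neq0).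
by rewrite ux; field; rewrite ?u_neq0 ?v_neq0.
Qed.

Lemma poly_tM p q : poly_t (p * q) = poly_t p * poly_t q.
Proof. exact: tofracM. Qed.

Lemma poly_tX p n : poly_t (p ^+ n) = poly_t p ^+ n.
Proof. exact: tofracXn. Qed.

Lemma poly_t_eq0 p : (poly_t p == 0) = (p == 0).
Proof. by rewrite /poly_t tofrac_eq0. Qed.

Lemma t1_neq0 : t1 != 0.
Proof. by rewrite poly_t_eq0 polyX_eq0. Qed.

Lemma poly_t_inj p q : poly_t p = poly_t q -> p = q.
Proof. by move/eqP; rewrite /poly_t tofrac_eq => /eqP. Qed.

Lemma poly_st_inj p q : poly_st p = poly_st q -> p = q.
Proof. by move/eqP; rewrite /poly_st tofrac_eq => /eqP. Qed.

Lemma Laurent_poly p : Laurent (poly_t p).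
Proof. by exists p, 0%N; rewrite expr0 divr1. Qed.

Lemma subring_Laurent : subring Laurent.
Proof.
split.
- by rewrite -[1](tofrac1 {poly int}); apply: Laurent_poly.
- by move=> _ [p [k ->]]; exists (- p), k; rewrite /poly_t tofracN mulNr.
- move=> _ _ [p [k ->]] [q [j ->]]; exists (p * 'X^j + q * 'X^k), (k + j)%N.
  rewrite /poly_t tofracD -!/(poly_t _) !poly_tM !poly_tX exprD.
  by rewrite addf_div // expf_neq0 // t1_neq0.
move=> _ _ [p [k ->]] [q [j ->]]; exists (p * q), (k + j)%N.
by rewrite poly_tM exprD invfM mulrACA.
Qed.

Lemma Laurent_generator l g : is_localized_gcd l g ->
  generates_smallest_principal_ideal Laurent
    (ideal_generated_by Laurent (fun x => exists2 p, p \in l & x = poly_t p))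
    (poly_t g).
Proof.
move=> [g_dvd g_loc].
apply: (generates_smallest_principal_idealP subring_Laurent).
- exact: Laurent_poly.
- move=> _ [p /g_dvd[c ->] ->]; exists (poly_t c); first exact: Laurent_poly.
  exact: poly_tM.
move=> _ [E [k ->]] l_E.
have [|v w [i ->] [j ->]|p p_l|w [i ->] [r g_r]] :=
  g_loc (fun w => exists n, w = 'X^n) _ _ E.
- by exists 0%N.
- by exists (i + j)%N; rewrite exprD.
- have [|_ [Q [j ->]] p_E] := l_E (poly_t p); first by exists p.
  exists 'X^(j + k); first by exists (j + k)%N.
  exists Q; apply: poly_t_inj; rewrite !poly_tM poly_tX exprD.
  exact: clear_denominators (expf_neq0 j t1_neq0) (expf_neq0 k t1_neq0) p_E.
exists (poly_t (r * 'X^k) / t1 ^+ i); first by exists (r * 'X^k), i.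
rewrite poly_tM poly_tX.
apply: restore_denominators (expf_neq0 i t1_neq0) (expf_neq0 k t1_neq0) _.
by rewrite -poly_tX -!poly_tM g_r.
Qed.

Lemma LambdaJ_at_ratio p : LambdaJ (at_ratio p).
Proof.
exists (homogenize p), 0%N, (size p), 0%N, 0%N.
rewrite poly_st_homogenize !expr0 mul1r !mulr1.
by rewrite (mulfK (expf_neq0 _ s_neq0)).
Qed.

Lemma at_ratio_inverted i k l :
  at_ratio (inverted i k l) * s ^+ (k + l) = poly_st (denominator i 0 k l).
Proof. exact/esym/poly_st_monomial/by_degree_denominator. Qed.

Lemma at_ratio_inverted_neq0 i k l : at_ratio (inverted i k l) != 0.
Proof.
apply: contraNneq (denominator_neq0 i 0 k l) => w0.
by rewrite -at_ratio_inverted w0 mul0r.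
Qed.

Lemma LambdaJ_inverted i k l : LambdaJ (at_ratio (inverted i k l))^-1.
Proof.
have -> : (at_ratio (inverted i k l))^-1 =
    s ^+ (k + l) * (poly_st (denominator i 0 k l))^-1.
  by rewrite -at_ratio_inverted invfM mulrCA (mulfV (expf_neq0 _ s_neq0)) mulr1.
apply: (subringM subring_LambdaJ); first exact: (LambdaJ_sX (k + l)%N).
exact: LambdaJ_denominator.
Qed.

(** Turns a factorization in [LambdaJ] into one of polynomials, which can be read
    degree by degree. *)
Lemma LambdaJ_factor (p : {poly int}) P Q i j k l i' j' k' l' :
    at_ratio p = poly_st Q / poly_st (denominator i' j' k' l')
                 * (poly_st P / poly_st (denominator i j k l)) ->
  exists N, by_degree Q * 'X^(size p) * by_degree P =
    (inverted i' k' l' * inverted i k l * p) *: 'X^N.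
Proof.
move/(clear_denominators (denominator_neq0 _ _ _ _) (denominator_neq0 _ _ _ _)).
have clear D D' : poly_st D' * poly_st D * at_ratio p = poly_st Q * poly_st P ->
    by_degree D' * by_degree D * (p *: 'X^(size p)) =
    by_degree Q * 'X^(size p) * by_degree P.
  move=> p_PQ; rewrite -by_degree_homogenize -by_degree_s -rmorphXn -!rmorphM.
  congr (by_degree _); apply: poly_st_inj.
  rewrite !poly_stM poly_st_homogenize poly_stX mulrA p_PQ.
  by rewrite -!mulrA; congr (_ * _); rewrite mulrC.
move/clear=> <-; exists (j' + k' + l' + (j + k + l) + size p)%N.
rewrite !by_degree_denominator.
by rewrite -!mul_polyC !exprD !polyCM; ring.
Qed.

Lemma scale_fraction (K : fieldType) (g r w e E D a b : K) :
    w != 0 -> a != 0 -> D != 0 -> w * g = r * e -> E = e * a ->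
  g * b = r * D * b * a^-1 * w^-1 * (E / D).
Proof.
move=> w_neq0 a_neq0 D_neq0 wg ->; apply: (mulfI w_neq0).
by rewrite [LHS]mulrA wg; field; rewrite ?w_neq0 ?a_neq0 ?D_neq0.
Qed.

(** A divisor [e] of a nonzero value at [t / s] is a factor of a homogeneous
    polynomial up to units, hence itself homogeneous up to units, hence a value
    at [t / s] up to units; this brings its divisibility down to [Z[T]], where
    the denominators [2], [T] and [1 + T] remain. *)
Lemma LambdaJ_generator l g : is_localized_gcd l g ->
  generates_smallest_principal_ideal LambdaJ
    (ideal_generated_by LambdaJ (fun x => exists2 p, p \in l & x = at_ratio p))
    (poly_st (homogenize g)).
Proof.
move=> [g_dvd g_loc]; have LM := subringM subring_LambdaJ.
apply: (generates_smallest_principal_idealP subring_LambdaJ).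
- exact: LambdaJ_poly.
- move=> _ [p /g_dvd[c ->] ->]; exists (at_ratio c * s ^ (- (size g)%:Z)).
    by apply: (LM); [apply: LambdaJ_at_ratio|apply: LambdaJ_sX].
  rewrite poly_st_homogenize rmorphM -exprnN.
  by rewrite mulrACA (mulVf (expf_neq0 _ s_neq0)) mulr1.
move=> _ /LambdaJP[P [i [j [k [m ->]]]]] l_P.
have [/hasP[p0 p0_l p0_neq0]|/hasPn l0] := boolP (has (predC1 0) l); last first.
  have [|v w -> ->|p /l0|w -> [c]] := g_loc (fun w => w = 1) _ _ 0 => //.
  - by rewrite mulr1.
  - by rewrite /= negbK => /eqP->; exists 1 => //; exists 0; rewrite !mulr0.
  rewrite mul1r mulr0 => ->; exists 0; first exact: (subring0 subring_LambdaJ).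
  by rewrite poly_st_homogenize rmorph0 !mul0r.
pose W w := exists i k l, w = inverted i k l.
have fact p : p \in l -> exists w Q N, [/\ W w, w != 0 &
    Q * by_degree P = (w * p) *: 'X^N].
  move=> p_l; have [|_ /LambdaJP[Q [i' [j' [k' [m' ->]]]]]] := l_P (at_ratio p).
    by exists p.
  move/LambdaJ_factor=> [N p_Q]; exists (inverted i' k' m' * inverted i k m).
  exists (by_degree Q * 'X^(size p)), N; split=> //.
    by rewrite invertedM; do 3!eexists.
  by rewrite invertedM inverted_neq0.
have [d [e P_d]] : exists d e, by_degree P = e *: 'X^d.
  have [w [Q [N [_ w_neq0 QP]]]] := fact p0 p0_l.
  have [|_ [e [_ [d [_ -> _]]]]] := monomial_factor _ QP; last by exists d, e.
  exact: mulf_neq0.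
have [|v w [i1 [k1 [m1 ->]]] [i2 [k2 [m2 ->]]]|p p_l|w [i' [k' [m' ->]]] [r g_r]] :=
  g_loc W _ _ e.
- by exists 0%N, 0%N, 0%N; rewrite /inverted !expr0 !mulr1.
- by rewrite invertedM; do 3!eexists.
- have [w [Q [N [Ww _]]]] := fact p p_l.
  rewrite P_d -scalerAr => /(congr1 (fun q : {poly {poly int}} => q`_N)).
  rewrite !coefZ coefXn eqxx mulr1 => w_p; exists w => //.
  by exists (Q * 'X^d)`_N; rewrite -w_p mulrC.
have e_g : at_ratio (inverted i' k' m') * at_ratio g = at_ratio r * at_ratio e.
  by rewrite -!rmorphM g_r.
have := scale_fraction (s ^+ size g) (at_ratio_inverted_neq0 _ _ _) (expf_neq0 d s_neq0)
  (denominator_neq0 i j k m) e_g (poly_st_monomial P_d).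
rewrite -poly_st_homogenize => ->; eexists; last by [].
apply: (LM); last exact: LambdaJ_inverted.
apply: (LM); last by rewrite exprnN; apply: LambdaJ_sX.
apply: (LM); last exact: (LambdaJ_sX (size g)).
by apply: (LM); [apply: LambdaJ_at_ratio|apply: LambdaJ_poly].
Qed.

(** * Units and the specialization at s = 1 *)

Definition unit_form (K : fieldType) (a b c u : K) : Prop :=
  exists (e : bool) (i k l : int), u = (-1) ^+ e * a ^ i * b ^ k * c ^ l.

Section UnitForms.
Variables (K : fieldType) (a b c : K).
Hypotheses (a_neq0 : a != 0) (b_neq0 : b != 0) (c_neq0 : c != 0).

Lemma unit_formM u v :
  unit_form a b c u -> unit_form a b c v -> unit_form a b c (u * v).
Proof.
move=> [e [i [k [l ->]]]] [e' [i' [k' [l' ->]]]].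
exists (e (+) e'), (i + i'), (k + k'), (l + l').
by rewrite signr_addb !expfzDr //; ring.
Qed.

Lemma unit_formV u : unit_form a b c u -> unit_form a b c u^-1.
Proof.
move=> [e [i [k [l ->]]]]; exists e, (- i), (- k), (- l).
by rewrite !invfM invr_sign !invr_expz.
Qed.

End UnitForms.

Lemma two_t_neq0 : 2%:R != 0 :> Qt.
Proof.
have [two_neq0 _] := prime_element_2.
by rewrite -poly_t_eq0 in two_neq0; rewrite /poly_t rmorph_nat in two_neq0.
Qed.

Lemma one_t_neq0 : 1 + t1 != 0.
Proof.
have [+ _] := prime_element_1X.
by rewrite -poly_t_eq0 /poly_t tofracD tofrac1.
Qed.

Lemma unit_at_s1M u v : unit_at_s1 u -> unit_at_s1 v -> unit_at_s1 (u * v).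
Proof. exact: unit_formM two_t_neq0 t1_neq0 one_t_neq0 _ _. Qed.

Lemma unit_at_s1V u : unit_at_s1 u -> unit_at_s1 u^-1.
Proof. exact: unit_formV. Qed.

Lemma unit_at_s1_inverted (e : bool) i k l :
  unit_at_s1 (poly_t ((-1) ^+ e * inverted i k l)).
Proof.
exists e, i, k, l; rewrite /inverted !mulrA !poly_tM !poly_tX.
by rewrite /poly_t tofracMn tofracN tofracD !tofrac1.
Qed.

Lemma associate_denominators (K : fieldType) (x a b u v : K) : x != 0 ->
  u != 0 -> v != 0 -> x = a / u * (b / v * x) -> a * b = u * v.
Proof.
move=> x_neq0 u_neq0 v_neq0; rewrite mulrA -{1}[x]mul1r => /(mulIf x_neq0).
by move/(clear_denominators u_neq0 v_neq0); rewrite mulr1 => ->.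
Qed.

(** [x] and [y] are inverse to each other, so the numerator of [y] divides a
    power of [T]. *)
Lemma Laurent_associate g A x y : g != 0 -> Laurent x -> Laurent y ->
  A = x * poly_t g -> poly_t g = y * A -> unit_at_s1 y.
Proof.
move=> g_neq0 [X [i ->]] [Y [j ->]] -> g_YX.
have XY : Y * X = inverted 0 (j + i) 0.
  apply: poly_t_inj; rewrite /inverted !expr0 mul1r mulr1 exprD !poly_tM !poly_tX.
  apply: associate_denominators _ (expf_neq0 j t1_neq0) (expf_neq0 i t1_neq0) g_YX.
  by rewrite poly_t_eq0.
have [e [i' [k' [l' ->]]]] := divisor_of_inverted XY.
apply: unit_at_s1M; first exact: unit_at_s1_inverted.
apply: unit_at_s1V; exists false, 0, j, 0.
by rewrite expr0 !expr0z !mul1r mulr1.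
Qed.

Lemma clear_one_denominator (K : fieldType) (x a b u : K) : u != 0 ->
  x = a / u * b -> x * u = a * b.
Proof. by move=> u_neq0 ->; rewrite mulrAC divfK. Qed.

(** Up to denominators [a] and [b] are polynomials whose product is a product of
    [2], [s], [t] and [s + t]; so they are homogeneous, and by unique
    factorization each of them becomes such a product of [2], [T] and [1 + T],
    up to sign. *)
Lemma LambdaJ_associate g P a b : g != 0 -> LambdaJ a -> LambdaJ b ->
    poly_st P = a * poly_st (homogenize g) ->
    poly_st (homogenize g) = b * poly_st P ->
  exists d p (e : bool) i k l i' k' l', by_degree P = p *: 'X^d /\
    p * inverted i k l = (-1) ^+ e * inverted i' k' l' * g.
Proof.
move=> g_neq0 /LambdaJP[X [i [j [k [l ->]]]]] /LambdaJP[Y [i' [j' [k' [l' ->]]]]].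
move=> P_g g_P.
have hom_neq0 : poly_st (homogenize g) != 0.
  apply: contra_eq_neq (by_degree_homogenize g) => /eqP.
  rewrite poly_st_eq0 => /eqP->; rewrite rmorph0 eq_sym -mul_polyC.
  by rewrite mulf_neq0 ?polyC_eq0 // -size_poly_eq0 size_polyXn.
have XY : by_degree X * by_degree Y = (inverted i k l * inverted i' k' l') *:
    'X^(j + k + l + (j' + k' + l')).
  have cancel D D' : poly_st X * poly_st Y = poly_st D * poly_st D' ->
      by_degree X * by_degree Y = by_degree D * by_degree D'.
    move=> XY; rewrite -!rmorphM; congr (by_degree _).
    by apply: poly_st_inj; rewrite !poly_stM.
  rewrite (cancel (denominator i j k l) (denominator i' j' k' l')).
    by rewrite !by_degree_denominator -!mul_polyC !exprD !polyCM; ring.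
  rewrite mulrC [RHS]mulrC; apply: associate_denominators hom_neq0 _ _ _.
  - exact: denominator_neq0.
  - exact: denominator_neq0.
  by rewrite -P_g.
rewrite invertedM in XY.
have [p [q [n [_ [X_p _ pq]]]]] := monomial_factor (inverted_neq0 _ _ _) XY.
have [e [i1 [k1 [l1 p_e]]]] := divisor_of_inverted pq.
have PD : by_degree P * (inverted i k l *: 'X^(j + k + l)) =
    (p * g) *: 'X^(n + size g).
  have cancel D : poly_st P * poly_st D = poly_st X * poly_st (homogenize g) ->
      by_degree P * by_degree D = by_degree X * by_degree (homogenize g).
    move=> PX; rewrite -!rmorphM; congr (by_degree _).
    by apply: poly_st_inj; rewrite !poly_stM.
  rewrite -by_degree_denominator cancel.
    by rewrite X_p by_degree_homogenize -!mul_polyC exprD polyCM; ring.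
  exact: clear_one_denominator (denominator_neq0 _ _ _ _) P_g.
have pg_neq0 : p * g != 0.
  rewrite mulf_neq0 //; apply: contraNneq (inverted_neq0 (i + i') (k + k') (l + l')).
  by rewrite -pq => ->; rewrite mul0r.
have [r [_ [d [_ [P_r _ _]]]]] := monomial_factor pg_neq0 PD.
exists d, r, e, i, k, l, i1, k1, l1; split=> //.
move/(congr1 (fun q : {poly {poly int}} => q.[1])): PD.
by rewrite P_r hornerM !hornerZ !hornerXn !expr1n !mulr1 p_e.
Qed.

Section JablanIdeal.
Variable L : link_diagram.

(** For a diagram with semiarcs both matrices present the same module; the empty
    diagram has no minors of corank one at all. *)
Lemma jablan_alexander_ideal x :
  ideal_generated_by LambdaJ (codim1_minor (alexander_matrix_at L (t / s))) x <->
  ideal_generated_by LambdaJ (codim1_minor (jablan_matrix (pseudolink_of_link L))) x.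
Proof.
have [w w_numbering] := alexander_numbering (shadow_planar (link_shadow L)).
rewrite jablan_matrixE.
have [no_semiarc|semiarc_gt0] := posnP #|semiarc L|.
  have no_arc : #|arcs L| = 0%N.
    apply/eqP; rewrite cards_eq0 -subset0; apply/subsetP=> z /imsetP[y _ _].
    by have := card0_eq no_semiarc y; rewrite inE.
  split; apply: (ideal_included subring_LambdaJ) => {x} x [k [f [g [eq_k]]]].
    by rewrite no_arc in eq_k.
  by rewrite no_semiarc in eq_k.
have arcs_gt0 : (0 < #|arcs L|)%N.
  have /card_gt0P[y _] := semiarc_gt0.
  by apply/card_gt0P; exists (arc_of y); apply: imset_f.
rewrite !(codim1_minor_ideal subring_LambdaJ) // -!subn1.
apply: (jablan_alexander_minor_ideal w_numbering subring_LambdaJ s_neq0) => //.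
- exact: LambdaJ_sX.
exact: LambdaJ_poly.
Qed.

End JablanIdeal.

Lemma eq_ideal_generated_by (K : fieldType) (S : K -> Prop) (X Y : K -> Prop) :
    subring S -> (forall x, X x <-> Y x) ->
  forall x, ideal_generated_by S X x <-> ideal_generated_by S Y x.
Proof.
by move=> S_sub XY x; split; apply: ideal_included => // {}x /XY; apply: ideal_gen.
Qed.

Theorem lemma8 (L : link_diagram) :
  [/\ exists P : {mpoly int[2]},
        jablan_polynomial (pseudolink_of_link L) (poly_st P),
      exists A : Qt, alexander_polynomial L A
    & forall P : {mpoly int[2]},
        jablan_polynomial (pseudolink_of_link L) (poly_st P) ->
        (exists d : nat, P \is d.-homog) /\
        (forall A : Qt, alexander_polynomial L A ->
           exists2 u : Qt, unit_at_s1 u & poly_t (at_s1 P) = u * A)].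
Proof.
have [l l_minors] := codim1_minors_enum (alexander_matrix_at L ('X : {poly int})).
have [g g_gcd] := localized_gcd l.
have gen_A : alexander_polynomial L (poly_t g).
  apply: eq_generates_smallest_principal_ideal (Laurent_generator g_gcd).
  apply: (eq_ideal_generated_by subring_Laurent) => x.
  rewrite alexander_matrixE -(l_minors Qt (@tofrac {poly int})).
  by rewrite map_alexander_matrix_at.
have gen_J : jablan_polynomial (pseudolink_of_link L) (poly_st (homogenize g)).
  apply: eq_generates_smallest_principal_ideal (LambdaJ_generator g_gcd) => x.
  rewrite -jablan_alexander_ideal.
  apply: (eq_ideal_generated_by subring_LambdaJ) => {}x.
  by rewrite -l_minors map_alexander_matrix_at at_ratioX.
split; [by exists (homogenize g) | by exists (poly_t g) | move=> P gen_P].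
have [a [b [La Lb P_g g_P]]] := generators_associated subring_LambdaJ gen_P gen_J.
have [g0|g_neq0] := eqVneq g 0.
  have -> : P = 0.
    apply: poly_st_inj; rewrite P_g poly_st_homogenize g0 rmorph0 mul0r mulr0.
    by rewrite /poly_st tofrac0.
  split=> [|A gen_A']; first by exists 0%N; apply: dhomog0.
  have [x [_ [_ _ -> _]]] := generators_associated subring_Laurent gen_A' gen_A.
  exists 1; first by exists false, 0, 0, 0; rewrite expr0 !expr0z !mulr1.
  by rewrite g0 /poly_t tofrac0 mulr0 mulr0 /at_s1 mmap0 tofrac0.
have [d [p [e [i [k [m [i' [k' [m' [P_d p_g]]]]]]]]]] :=
  LambdaJ_associate g_neq0 La Lb P_g g_P.
split=> [|A gen_A']; first by exists d; apply: homogeneous_of_by_degree P_d.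
have [x [y [Lx Ly A_g g_A]]] := generators_associated subring_Laurent gen_A' gen_A.
exists ((poly_t (inverted i k m))^-1 * (poly_t ((-1) ^+ e * inverted i' k' m') * y)).
  apply: unit_at_s1M.
    apply: unit_at_s1V.
    by have := unit_at_s1_inverted false i k m; rewrite expr0 mul1r.
  by apply: unit_at_s1M (Laurent_associate g_neq0 Lx Ly A_g g_A);
    apply: unit_at_s1_inverted.
rewrite -!mulrA -g_A -poly_tM -p_g (poly_tM p) [poly_t p * _]mulrC.
have w_neq0 : poly_t (inverted i k m) != 0 by rewrite poly_t_eq0 inverted_neq0.
rewrite (mulKf w_neq0).
by rewrite at_s1_by_degree P_d hornerZ hornerXn expr1n mulr1.
Qed.
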